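(* A graph $G$ is chordal if and only if $\textrm{ML-degree}(G)=1$.
   Context: $G=([m],E)$ is a finite undirected graph, where by convention $E$ contains all self-loops $(i,i)$. $G$ is chordal if every induced cycle of length at least $4$ has a chord (that is, $G$ has no chordless cycle of length $\ge 4$ as an induced subgraph). $\textrm{ML-degree}(G)$ is the ML degree of the Gaussian graphical model of $G$ (multivariate normal distributions whose concentration matrix $K=\Sigma^{-1}$ satisfies $K_{ij}=0$ for $(i,j)\notin E$). Concretely, for a generic symmetric matrix $S\in\mathbb{S}^m$ it is the number of complex invertible symmetric $m\times m$-matrices $\Sigma$ such that $\Sigma_{ij}=S_{ij}$ for all $(i,j)\in E$ and $(\Sigma^{-1})_{ij}=0$ for all $(i,j)\notin E$. *)

(* Defs.v *)
From HB Require Import structures.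
From mathcomp Require Import all_boot all_order all_algebra.
From mathcomp Require Import boolp classical_sets functions cardinality reals.
From mathcomp Require Import complex.
(* Not imported: the notations of mpoly clash with those of the topology
   files of MathComp-Analysis. *)
From mathcomp Require mpoly.

Set Implicit Arguments.
Unset Strict Implicit.
Unset Printing Implicit Defensive.

Import Order.TTheory GRing.Theory Num.Theory.
Local Open Scope ring_scope.
Local Open Scope classical_set_scope.
Local Open Scope card_scope.
Local Open Scope complex_scope.

(* A chord joins two distinct vertices of c that are not consecutive on c. *)
Definition has_chord (T : eqType) (E : rel T) (c : seq T) : Prop :=
  exists x y : T, [/\ x \in c /\ y \in c, x != y,
    y != next c x /\ x != next c y & E x y].

(* Induced cycles are exactly the chordless ones, so "no induced cycle of
   length at least 4" reads: every simple cycle of length at least 4 has a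
   chord. *)
Definition chordal (T : eqType) (E : rel T) : Prop :=
  forall c : seq T, ucycle E c -> (4 <= size c)%N -> has_chord E c.

Section MLDegree.
Variables (R : realType) (m : nat).

(* The polynomial function f on m x m matrices, in the m * m entries. *)
Definition mxeval (f : mpoly.mpoly (m * m) R) (S : 'M[R]_m) : R :=
  mpoly.meval (fun k => mxvec S 0 k) f.

(* P holds on a nonempty Zariski-open subset of the real symmetric matrices.
   f must be nonzero as a function on symmetric matrices, which is stronger
   than being a nonzero polynomial in m * m variables. *)
Definition for_generic_symmetric (P : 'M[R]_m -> Prop) : Prop :=
  exists2 f : mpoly.mpoly (m * m) R,
    exists2 S0 : 'M[R]_m, S0^T = S0 & mxeval f S0 != 0 &
    forall S : 'M[R]_m, S^T = S -> mxeval f S != 0 -> P S.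

Definition critical_points (E : rel 'I_m) (S : 'M[R]_m) : set 'M[R[i]]_m :=
  [set Sigma | [/\ Sigma \in unitmx, Sigma^T = Sigma,
    forall i j, E i j -> Sigma i j = (S i j)%:C &
    forall i j, ~~ E i j -> invmx Sigma i j = 0]].

Definition has_ML_degree (E : rel 'I_m) (d : nat) : Prop :=
  for_generic_symmetric (fun S => critical_points E S #= `I_d).

(* The default 0 is returned if no generic number of critical points exists;
   by has_ML_degree_uniq there is at most one. *)
Definition ML_degree (E : rel 'I_m) : nat := xget 0%N (has_ML_degree E).

Lemma mxeval_line (f : mpoly.mpoly (m * m) R) (S0 S1 : 'M[R]_m) :
  exists p : {poly R}, forall t, p.[t] = mxeval f (S0 + t *: (S1 - S0)).
Proof.
exists (mpoly.mmap (@polyC R)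
  (fun k => (mxvec S0 0 k)%:P + (mxvec (S1 - S0) 0 k) *: 'X) f) => t.
rewrite /mxeval /mpoly.meval /mpoly.mmap horner_sum; apply: eq_bigr => a _.
rewrite hornerM hornerC /mpoly.mmap1 horner_prod; congr (_ * _).
apply: eq_bigr => k _; rewrite horner_exp; congr (_ ^+ _).
rewrite !hornerE [_ + t *: _]addrC linearP !mxE addrC; congr (_ + _); exact: mulrC.
Qed.

Lemma for_generic_symmetricI (P Q : 'M[R]_m -> Prop) :
  for_generic_symmetric P -> for_generic_symmetric Q ->
  exists S : 'M[R]_m, [/\ S^T = S, P S & Q S].
Proof.
move=> [f [S0 S0s fS0] fP] [g [S1 S1s gS1] gQ].
have [p pE] := mxeval_line f S0 S1; have [q qE] := mxeval_line g S0 S1.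
have p0 : p != 0.
  by apply: contra_neq fS0 => p0; have := pE 0; rewrite p0 horner0 scale0r addr0.
have q0 : q != 0.
  apply: contra_neq gS1 => q0.
  by have := qE 1; rewrite q0 horner0 scale1r addrC subrK.
pose s : seq R := [seq k%:R | k <- iota 0 (size (p * q)%R)].
have us : uniq s.
  by rewrite map_inj_uniq ?iota_uniq // => x y /eqP; rewrite eqr_nat => /eqP.
have : ~~ all (root (p * q)) s.
  apply/negP => rs; have := max_poly_roots (mulf_neq0 p0 q0) rs us.
  by rewrite size_map size_iota ltnn.
move=> /allPn[t _]; rewrite /root hornerM mulf_eq0 negb_or pE qE => /andP[ft gt].
exists (S0 + t *: (S1 - S0)).
have St : (S0 + t *: (S1 - S0))^T = S0 + t *: (S1 - S0).
  by rewrite linearD linearZ /= linearB /= S0s S1s.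
by split => //; [exact: fP | exact: gQ].
Qed.

Lemma has_ML_degree_uniq (E : rel 'I_m) (d e : nat) :
  has_ML_degree E d -> has_ML_degree E e -> d = e.
Proof.
move=> Ed Ee; have [S [_ Sd Se]] := for_generic_symmetricI Ed Ee.
by apply/card_eq_II; apply: card_eq_trans Se; rewrite card_eq_sym.
Qed.

Lemma ML_degreeE (E : rel 'I_m) (d : nat) :
  has_ML_degree E d -> ML_degree E = d.
Proof.
by move=> Ed; apply: xget_unique => // e /has_ML_degree_uniq -/(_ _ Ed).
Qed.

End MLDegree.

(* Main.v *)
Require Import Defs.
From HB Require Import structures.
From mathcomp Require Import all_boot all_order all_algebra.
From mathcomp Require Import boolp classical_sets functions cardinality reals.
From mathcomp Require Import topology normedtype sequences interval_inference.
From mathcomp Require Import trigo polyrcf complex.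
From mathcomp Require Import zify ring lra.
From mathcomp Require mpoly.
Import (canonicals) mpoly.

Set Implicit Arguments.
Unset Strict Implicit.
Unset Printing Implicit Defensive.

Import Order.TTheory GRing.Theory Num.Theory.
Import numFieldNormedType.Exports.


(* If G is chordal, remove a simplicial vertex v (Dirac).  With alpha the vector
   of regression coefficients of v on its neighbours, which depends on S only,
   the shear T = 1 + e_v alpha maps the critical points of (G - v, S'), where S'
   isolates v and has the Schur complement in entry (v, v), bijectively to those
   of (G, S) by Sigma |-> T Sigma T^T.  By induction there is exactly one as soon
   as all principal minors of S are nonzero.

   If c is a chordless cycle of length n >= 4 with adjacency matrix U, extended
   by 0 outside of c, consider K(s) = 1 - s U.  For s = 1 / (2 cos 2a) its
   inverse is, up to scaling the block of c, the matrix with entries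
   cos ((2 d - n) a) at distance d along c.  Scaled to have diagonal 1, it has
   cos ((n - 2) a) / cos (n a) on the edges of c, and each x > 1 is the value of
   this ratio at two angles in (0, pi / 2).  So two different critical points
   share the same data S.  Outside of the zeros of a polynomial in s, nonzero
   since K(0) = 1 is nondegenerate, both are nondegenerate, and hence persist
   for all data near S by the implicit function theorem. *)

(** * Simplicial vertices of chordal graphs *)

Section Graph.
Variable T : finType.
Implicit Types (E e : rel T) (A B W : {set T}).

(** A path of minimal length works: any edge from one of its vertices to a later, non-consecutive
    one would be a shortcut. *)
Lemma connect_induced_path e x y : connect e x y ->
  exists2 p, [/\ path e x p, last x p = y & uniq (x :: p)] &
    forall i j, i < j <= size p ->
      e (nth x (x :: p) i) (nth x (x :: p) j) -> j = i.+1.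
Proof.
move=> /connectP[p0 ep0 lp0].
pose P n := [exists p : n.-tuple T, path e x p && (last x p == y)].
have exP : exists n, P n.
  by exists (size p0); apply/existsP; exists (in_tuple p0); rewrite ep0 lp0 /=.
case: (ex_minnP exP) => n /existsP[p1 /andP[ep1 /eqP lp1]] nmin.
have {}nmin p : path e x p -> last x p = y -> n <= size p.
  move=> ep lp; apply: nmin; apply/existsP; exists (in_tuple p).
  by rewrite ep lp /=.
have [p [ep lp up pn]] : exists p, [/\ path e x p, last x p = y,
    uniq (x :: p) & size p <= n].
  case/shortenP: ep1 lp1 => p' ep' up' sp' lp'; exists p'; split => //.
  rewrite -(size_tuple p1); apply: uniq_leq_size => //.
  by case/andP: up'.
exists p => // i j /andP[ij jp] eij.
have xpj : drop j.-1 p = nth x (x :: p) j :: drop j p.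
  case: j ij jp {eij} => // j ij jp /=.
  by rewrite (drop_nth x).
have lti : last x (take i p) = nth x (x :: p) i.
  have ip : i < size p := leq_trans ij jp.
  rewrite (last_nth x) size_take ip -[x :: take i p]/(take i.+1 (x :: p)).
  by rewrite nth_take.
(* The edge [eij] replaces the stretch between positions [i] and [j]. Positions refer to [x :: p],
   so [drop j.-1 p] starts with the vertex at position [j]. *)
have := nmin (take i p ++ drop j.-1 p).
rewrite cat_path last_cat lti xpj /= eij.
move: ep lp; rewrite -{1 2}(cat_take_drop j p) cat_path last_cat.
have -> : last x (take j p) = nth x (x :: p) j.
  rewrite (last_nth x) size_takel //.
  by rewrite -[x :: take j p]/(take j.+1 (x :: p)) nth_take.
move=> /andP[epj ->] ->.
have -> : path e x (take i p).
  have: path e x (take j p) by [].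
  rewrite -(subnKC (ltnW ij)) takeD cat_path; by case/andP.
move=> /(_ isT erefl); rewrite size_cat /= size_drop size_takel; last first.
  exact: leq_trans (ltnW ij) jp.
move=> /(leq_trans pn) h; apply/eqP; rewrite eqn_leq ij andbT.
lia.
Qed.

(* Otherwise a shortest path from b1 to b2 through A, closed up by u, is a
   chordless cycle. *)
Lemma chordal_common_neighbours E A u b1 b2 : symmetric E -> chordal E ->
  b1 != b2 -> E u b1 -> E u b2 -> u != b1 -> u != b2 -> u \notin A ->
  {in A, forall a, ~~ E u a} ->
  connect [rel x y | E x y && (y \in b2 |: A)] b1 b2 -> E b1 b2.
Proof.
move=> E_sym chE b12 Eu1 Eu2 u1 u2 uA EuA; set e := [rel x y | _].
move=> /connect_induced_path[p [ep lp up] pmin].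
case: (boolP (E b1 b2)) => // /negP nE12; exfalso.
have pB : {subset p <= b2 |: A}.
  move: ep; elim: p b1 {up pmin lp b12 Eu1 u1 nE12} => //= z p IH b /andP[].
  by move=> /andP[_ zB] /IH sub t; rewrite inE => /predU1P[->|/sub].
(* Together with [u] and [b1] this gives the cycle length at least 4. *)
have size_p : 2 <= size p.
  case: p ep lp {up pmin pB} => [_ /= /eqP|z [|//]]; first by rewrite (negPf b12).
  by move=> /= /andP[/andP[Ez _] _] zE; case: nE12; rewrite -zE.
pose c := u :: b1 :: p.
have uc : uniq c.
  rewrite /c cons_uniq up andbT inE (negPf u1) /=; apply/negP => /pB.
  by rewrite !inE (negPf u2) (negPf uA).
have cE : ucycle E c.
  apply/andP; split => //; rewrite /c /= Eu1 rcons_path lp E_sym Eu2 andbT.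
  by apply: sub_path ep => x y /andP[].
have [x [y [[xc yc] xy [nxy nyx] Exy]]] := chE c cE size_p.
wlog ij : x y xc yc xy nxy nyx Exy / index x c < index y c.
  move=> H; case: (ltngtP (index x c) (index y c)) => h.
  - exact: (H x y).
  - by apply: (H y x) => //; rewrite 1?eq_sym 1?E_sym.
  - by case/eqP: xy; rewrite -(nth_index u xc) h nth_index.
(* A chord at [u] can only end in [b1] or [b2], since [u] has no neighbour in [A]; but these are
   next to [u] on the cycle. *)
have [xu|xu] := eqVneq x u.
  subst x; have := yc; rewrite !inE eq_sym (negPf xy) /= => /predU1P[yb1|yp].
    by move: nxy; rewrite /c /= eqxx yb1 eqxx.
  have := pB _ yp; rewrite !inE => /predU1P[yb2|yA]; last first.
    by move: (EuA _ yA); rewrite Exy.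
  move: nyx; rewrite next_nth yc /c.
  have -> : index y (u :: b1 :: p) = size (b1 :: p).
    rewrite yb2 -lp -[last b1 p]/(last u (b1 :: p)) (last_nth u).
    by rewrite index_uniq.
  by rewrite nth_default // eqxx.
have yu : y != u by apply: contraTneq ij => ->; rewrite /c /= eqxx.
have yp : y \in b1 :: p by move: yc; rewrite [y \in c]in_cons (negPf yu).
have xp : x \in b1 :: p by move: xc; rewrite [x \in c]in_cons (negPf xu).
have ixE z : z != u -> index z c = (index z (b1 :: p)).+1.
  by move=> zu; rewrite /c /= [u == z]eq_sym (negPf zu).
have yB : y \in b2 |: A.
  apply: pB; move: yp; rewrite [y \in b1 :: p]in_cons => /predU1P[yb|//].
  by move: ij; rewrite !ixE // ltnS yb /= eqxx ltn0.
(* A chord avoiding [u] joins two vertices of the induced path, which must then be consecutive. *)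
have := pmin (index x (b1 :: p)) (index y (b1 :: p)).
have ij' : index x (b1 :: p) < index y (b1 :: p) by rewrite -ltnS -!ixE.
rewrite ij' -ltnS -[(size p).+1]/(size (b1 :: p)) index_mem yp.
rewrite !nth_index // /e /= Exy yB => /(_ isT isT) iE.
case/eqP: nxy; rewrite next_nth xc /c ixE // -/c.
by rewrite -iE nth_index.
Qed.

Definition simplicial E W v : Prop :=
  {in W &, forall x y, E v x -> E v y -> E x y}.

(** Dirac's argument, by induction on [#|W|]. Let [A] be a component of the non-neighbours of [u],
    with boundary [B]. Then [B] is a clique of neighbours of [u], and [A :|: B] omits [u]. The
    induction provides a vertex of [A] simplicial in [A :|: B], which contains all its neighbours in
    [W]. *)
Lemma chordal_simplicial_avoid E W u :
  symmetric E -> reflexive E -> chordal E -> u \in W ->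
  (exists2 z, z \in W & ~~ E u z) ->
  exists w, [/\ w \in W, ~~ E u w & simplicial E W w].
Proof.
move=> E_sym E_refl chE.
have [k] := ubnP #|W|; elim: k W u => // k IH W u Wk uW [q qW nuq].
(* A is a component of the non-neighbours of u in W, and B is its boundary. *)
pose Q := [set x in W | ~~ E u x].
pose eQ := [rel x y | [&& E x y, x \in Q & y \in Q]].
have eQ_sym : symmetric eQ.
  by move=> x y; rewrite /eQ /= E_sym [(y \in Q) && _]andbC.
pose A := [set a | connect eQ q a].
pose B := [set b in W | (b \notin A) && [exists a in A, E a b]].
have qQ : q \in Q by rewrite inE qW.
have AQ : {subset A <= Q}.
  move=> a; rewrite inE => /connectP[p].
  elim: p q {qW nuq A B} qQ => [|z p IHp] q qQ /=; first by move=> _ ->.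
  by move=> /andP[/and3P[_ _ zQ]]; exact: IHp.
have AW : {subset A <= W} by move=> a /AQ; rewrite inE => /andP[].
have AN a : a \in A -> ~~ E u a by move=> /AQ; rewrite inE => /andP[].
have Anbr a b : a \in A -> b \in Q -> E a b -> b \in A.
  move=> aA bQ Eab; rewrite inE; apply: (@connect_trans _ _ a).
    by move: aA; rewrite inE.
  by apply: connect1; rewrite /eQ /= Eab AQ.
have BN b : b \in B -> E u b.
  rewrite inE => /and3P[bW nbA /existsP[a /andP[aA Eab]]].
  by apply: contraNT nbA => nub; apply: (Anbr a) => //; rewrite inE bW.
have uA : u \notin A by apply/negP => /AN; rewrite E_refl.
have Bu b : b \in B -> u != b.
  rewrite inE => /and3P[bW nbA /existsP[a /andP[aA Eab]]].
  by apply: contraTneq Eab => <-; rewrite E_sym AN.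
have Bclique : {in B &, forall b1 b2, E b1 b2}.
  move=> b1 b2 b1B b2B; have [->|b12] := eqVneq b1 b2; first exact: E_refl.
  apply: (chordal_common_neighbours (A := A) E_sym chE b12 (BN _ b1B) (BN _ b2B)
    (Bu _ b1B) (Bu _ b2B) uA AN).
  move: (b1B) (b2B); rewrite !inE.
  move=> /and3P[_ _ /existsP[a1 /andP[a1A E1]]].
  move=> /and3P[_ _ /existsP[a2 /andP[a2A E2]]].
  apply: (@connect_trans _ _ a1).
    by apply: connect1; rewrite /= E_sym E1 finset.in_setU a1A orbT.
  apply: (@connect_trans _ _ a2); last first.
    by apply: connect1; rewrite /= E2 finset.in_setU1 eqxx.
  have : connect eQ a1 a2.
    apply: (@connect_trans _ _ q); last by rewrite inE in a2A.
    by rewrite (sym_connect_sym eQ_sym); rewrite inE in a1A.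
  move=> /connectP[p ep ->]; elim: p a1 a1A ep {E1} => //= z p IHp a1 a1A.
  move=> /andP[/and3P[Ez a1Q zQ] ep].
  have zA : z \in A by apply: (Anbr a1).
  apply: connect_trans (IHp _ zA ep).
  by apply: connect1; rewrite /= Ez finset.in_setU zA orbT.
have [w wA sw] : exists2 w, w \in A & simplicial E (A :|: B) w.
  have lt_card : #|A :|: B| < k.
    rewrite -ltnS; apply: leq_trans Wk; rewrite ltnS; apply: fintype.proper_card.
    apply/fintype.properP; split.
      by apply/fintype.subsetP => x /finset.setUP[/AW//|]; rewrite inE => /andP[].
    exists u => //; rewrite finset.in_setU (negPf uA) /=.
    by apply/negP => /Bu; rewrite eqxx.
  (* If some [b] in [B] has a non-neighbour, the simplicial vertex found avoiding [b] lies outside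
     of the clique [B], hence in [A]. *)
  have [/existsP[b /andP[bB /existsP[z /andP[zW nbz]]]]|uniB] :=
      boolP [exists b in B, [exists z in A :|: B, ~~ E b z]].
    have bAB : b \in A :|: B by rewrite finset.in_setU bB orbT.
    have [w [/finset.setUP[wA|wB] nbw sw]] :=
      IH _ b lt_card bAB (ex_intro2 _ _ z zW nbz).
      by exists w.
    by rewrite Bclique in nbw.
  have {}uniB b z : b \in B -> z \in A :|: B -> E b z.
    move=> bB zW; apply: contraNT uniB => nbz.
    by apply/existsP; exists b; rewrite bB /=; apply/existsP; exists z; rewrite zW.
  (* Now [B] is adjacent to all of [A :|: B], so a vertex not adjacent to some [a] in [A] lies in
     [A] again. *)
  have [/existsP[a /andP[aA /existsP[z /andP[zW naz]]]]|uniA] :=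
      boolP [exists a in A, [exists z in A :|: B, ~~ E a z]].
    have aAB : a \in A :|: B by rewrite finset.in_setU aA.
    have [w [/finset.setUP[wA|wB] naw sw]] :=
      IH _ a lt_card aAB (ex_intro2 _ _ z zW naz).
      by exists w.
    by rewrite E_sym uniB in naw.
  (* In the remaining case [A :|: B] is a clique, and any vertex of [A] will do. *)
  have qA : q \in A by rewrite inE connect0.
  exists q => // x y xW yW _ _; case/finset.setUP: xW => [xA|xB]; last exact: uniB.
  apply: contraNT uniA => nxy; apply/existsP; exists x; rewrite xA.
  by apply/existsP; exists y; rewrite yW.
exists w; split; [exact: AW | exact: AN |] => x y xW yW Ewx Ewy.
suff sub z : z \in W -> E w z -> z \in A :|: B by apply: sw; auto.
move=> zW Ewz; rewrite finset.in_setU; case: (boolP (z \in A)) => //= nzA.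
by rewrite inE zW nzA; apply/existsP; exists w; rewrite wA.
Qed.

Lemma chordal_simplicial E W : symmetric E -> reflexive E -> chordal E ->
  W != finset.set0 -> exists2 w, w \in W & simplicial E W w.
Proof.
move=> E_sym E_refl chE /finset.set0Pn[u uW].
have [/existsP[x /andP[xW /existsP[z /andP[zW nxz]]]]|uni] :=
    boolP [exists x in W, [exists z in W, ~~ E x z]].
  have [w [wW _ sw]] := chordal_simplicial_avoid E_sym E_refl chE xW
    (ex_intro2 _ _ z zW nxz).
  by exists w.
exists u => // x y xW yW _ _; apply: contraNT uni => nxy.
by apply/existsP; exists x; rewrite xW; apply/existsP; exists y; rewrite yW.
Qed.

End Graph.

(** Brings the absence of chords into the form in which it is used with [cycle_adj]. *)
Lemma chordless_edge (T : eqType) (E : rel T) (c : seq T) :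
  symmetric E -> reflexive E -> ucycle E c -> ~ has_chord E c ->
  {in c &, forall x y, E x y =
    (x == y) || [&& x \in c, y \in c & (y == next c x) || (x == next c y)]}.
Proof.
move=> E_sym E_refl /andP[cE _] nc x y xc yc; rewrite xc yc /=.
have [<-|xy] := eqVneq x y; first exact: E_refl.
rewrite /=; apply/idP/idP => [Exy|/orP[]/eqP->]; last 2 first.
- exact: next_cycle.
- by rewrite E_sym next_cycle.
rewrite -[_ || _]negbK negb_or; apply/negP => /andP[nxy nyx]; apply: nc.
by exists x, y.
Qed.

(** * Completions of partial symmetric matrices over a field *)

Section Completion.
Local Open Scope ring_scope.
Variables (F : fieldType) (m : nat).
Implicit Types (E : rel 'I_m) (S X K Sigma : 'M[F]_m) (A N W : {set 'I_m}).

Lemma mulmx1_invmx X K : X *m K = 1%:M -> invmx X = K.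
Proof.
move=> XK; have [uX _] := mulmx1_unit XK.
by rewrite -[invmx X]mulmx1 -XK mulKmx.
Qed.

Lemma unitmx_rker p (X : 'M[F]_p) :
  (forall w : 'rV_p, w *m X = 0 -> w = 0) -> X \in unitmx.
Proof. by move=> h; rewrite -row_free_unit; apply: inj_row_free. Qed.

Lemma lin_mx_unitP (L : {linear 'M[F]_m -> 'M[F]_m}) :
  lin_mx L \in unitmx <-> (forall X, L X = 0 -> X = 0).
Proof.
split=> [uL X LX|L_inj].
  apply: (can_inj mxvecK); apply: (row_free_inj (A := lin_mx L)).
    by rewrite row_free_unit.
  by rewrite mul_vec_lin LX !linear0 mul0mx.
apply: unitmx_rker => w; rewrite -[w]vec_mxK mul_vec_lin => /eqP.
by rewrite mxvec_eq0 => /eqP/L_inj ->; rewrite linear0.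
Qed.

(** The conditions of [critical_points], with data and solution over one field, so that both real
    and complex solutions are covered. *)
Definition completion E S Sigma : Prop :=
  [/\ Sigma \in unitmx, Sigma^T = Sigma,
    forall i j, E i j -> Sigma i j = S i j &
    forall i j, ~~ E i j -> invmx Sigma i j = 0].

(** The principal submatrix on [A], padded with the identity to keep the size [m]; its determinant
    is the principal minor. *)
Definition submask S A : 'M[F]_m :=
  \matrix_(i, j) if (i \in A) && (j \in A) then S i j else (i == j)%:R.

Lemma trmxE p q (X : 'M[F]_(p, q)) i j : X i j = X^T j i.
Proof. by rewrite mxE. Qed.

(** * Elimination of a simplicial vertex by a shear *)

Section Elimination.
Variables (v : 'I_m) (al : 'rV[F]_m).
Hypothesis al_v : al 0 v = 0.

Definition shear (c : F) : 'M[F]_m := 1%:M + c *: (delta_mx v 0 *m al).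

Lemma shearK c : shear c *m shear (- c) = 1%:M.
Proof.
rewrite /shear mulmxDl mul1mx mulmxDr mulmx1 -scalemxAl -scalemxAr scalerA.
rewrite -mulmxA [al *m (_ *m _)]mulmxA.
have -> : al *m (delta_mx v 0 : 'cV_m) = 0.
  by apply/matrixP => i j; rewrite !ord1 -colE !mxE.
by rewrite mul0mx mulmx0 scaler0 addr0 scaleNr addrNK.
Qed.

Lemma shear_entry c p (X : 'M_(m, p)) i j :
  (shear c *m X) i j = X i j + c * ((i == v)%:R * (al *m X) 0 j).
Proof.
rewrite /shear mulmxDl mul1mx -scalemxAl -mulmxA !mxE big_ord1 !mxE.
by rewrite eqxx andbT.
Qed.

Lemma shear_tr_entry c p (X : 'M_(m, p)) i j :
  ((shear c)^T *m X) i j = X i j + c * (al 0 i * X v j).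
Proof.
rewrite /shear linearD linearZ /= trmx_mul trmx1 mulmxDl mul1mx -scalemxAl.
rewrite !mxE; congr (_ + _ * _).
rewrite (bigD1 v) //= big1 => [|k kv]; rewrite !mxE big_ord1 !mxE.
  by rewrite !eqxx mulr1 addr0.
by rewrite (negPf kv) mulr0 mul0r.
Qed.

Lemma shear_congr c X i j : X^T = X ->
  (shear c *m X *m (shear c)^T) i j =
  X i j + (if i == v then c * (al *m X) 0 j else 0)
   + (if j == v then c * (al *m X) 0 i else 0)
   + (if (i == v) && (j == v) then c * c * (al *m X *m al^T) 0 0 else 0).
Proof.
move=> Xs; rewrite [LHS]trmxE trmx_mul trmxK.
rewrite shear_entry [_^T j i]mxE shear_entry.
have -> : (al *m (shear c *m X)^T) 0 i =
    (al *m X) 0 i + c * ((i == v)%:R * (al *m X *m al^T) 0 0).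
  rewrite [LHS]trmxE trmx_mul trmxK -[shear c *m X *m _]mulmxA shear_entry mulmxA.
  by congr (_ + _); rewrite -{1}Xs -trmx_mul mxE.
by case: (i == v); case: (j == v); rewrite /= ?mulr0n ?mulr1n; ring.
Qed.

Lemma shear_tr_congr c X i j : X^T = X ->
  ((shear c)^T *m X *m shear c) i j =
  X i j + c * (al 0 i * X v j) + c * (al 0 j * X v i)
   + c * c * (al 0 i * al 0 j * X v v).
Proof.
move=> Xs; have XE k l : X k l = X l k by rewrite -{1}Xs mxE.
rewrite [LHS]trmxE trmx_mul.
rewrite shear_tr_entry [_^T j i]mxE [_^T v i]mxE !shear_tr_entry (XE i v).
by ring.
Qed.

Variables (E E' : rel 'I_m) (S : 'M[F]_m).
Hypothesis E_sym : symmetric E.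
Hypothesis E_refl : reflexive E.
Hypothesis v_simplicial : forall x y, E v x -> E v y -> E x y.
Hypothesis E'E : forall x y, E' x y = (x == y) || [&& x != v, y != v & E x y].
Hypothesis S_sym : S^T = S.

(** These make [al] the vector of regression coefficients of [v] on its neighbours: [al_S] states
    the normal equations, and [S_N_inj] the invertibility of the block of [S] on the neighbours. *)
Hypothesis al_supp : forall j, ~~ E v j -> al 0 j = 0.
Hypothesis al_S : forall j, E v j -> j != v ->
  \sum_k al 0 k * S k j = S v j.
Hypothesis S_N_inj : forall w : 'I_m -> F,
  (forall j, ~~ (E v j && (j != v)) -> w j = 0) ->
  (forall j, E v j -> j != v -> \sum_k w k * S k j = 0) ->
  forall j, w j = 0.

Definition schur_entry : F := S v v - \sum_k al 0 k * S k v.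

Definition eliminate : 'M[F]_m :=
  \matrix_(i, j) if i == v then (if j == v then schur_entry else 0)
                 else if j == v then 0 else S i j.

Lemma al_neq0 j : al 0 j != 0 -> E v j && (j != v).
Proof.
move=> alj; apply/andP; split.
  by apply: contraNT alj => /al_supp ->.
by apply: contraNneq alj => ->; rewrite al_v.
Qed.

Lemma mul_al_entry X j : (forall k, E v k -> k != v -> X k j = S k j) ->
  (al *m X) 0 j = \sum_k al 0 k * S k j.
Proof.
move=> XS; rewrite mxE; apply: eq_bigr => k _.
have [->|/al_neq0/andP[vk kv]] := eqVneq (al 0 k) 0; first by rewrite !mul0r.
by rewrite XS.
Qed.

Lemma al_quad X : (forall k l, E v k -> E v l -> k != v -> l != v -> X k l = S k l) ->
  (al *m X *m al^T) 0 0 = \sum_k al 0 k * S k v.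
Proof.
move=> XS; rewrite mxE; apply: eq_bigr => k _; rewrite [al^T k 0]mxE.
have [->|/al_neq0/andP[vk kv]] := eqVneq (al 0 k) 0.
  by rewrite mulr0 mul0r.
rewrite mulrC; congr (_ * _).
rewrite mul_al_entry => [|l vl lv]; last by rewrite XS.
by rewrite al_S // -[in RHS]S_sym mxE.
Qed.

(** Row [v] of the inverse [K] is [- K v v *: al] off the diagonal, so the shear clears it. The
    other entries of [K] change by a multiple of [al 0 i * al 0 j], which is nonzero only if [i] and
    [j] are neighbours of [v] and hence adjacent. In [Sigma] only row and column [v] change. *)
Lemma completion_eliminate Sigma : completion E S Sigma ->
  completion E' eliminate (shear (- 1) *m Sigma *m (shear (- 1))^T).
Proof.
move=> [uS Ss SE SK]; set K := invmx Sigma in SK.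
have Ks : K^T = K by rewrite trmx_inv Ss.
have SsE i j : Sigma i j = Sigma j i by rewrite [LHS]trmxE Ss.
have KsE i j : K i j = K j i by rewrite [LHS]trmxE Ks.
have S_N k l : E v k -> E v l -> Sigma k l = S k l.
  by move=> vk vl; apply: SE; apply: v_simplicial.
(* By row [v] of [K *m Sigma = 1] and the normal equations, the vector [K v k + K v v * al 0 k] is
   in the left kernel of the block on the neighbours. *)
have Kv k : k != v -> K v k = - (K v v * al 0 k).
  have [vk|nvk] := boolP (E v k); last first.
    by move=> _; rewrite SK // al_supp // mulr0 oppr0.
  move=> kv; apply/eqP; rewrite -addr_eq0; apply/eqP.
  pose w j := if E v j && (j != v) then K v j + K v v * al 0 j else 0.
  have := @S_N_inj w _ _ k; rewrite /w vk kv; apply.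
    by move=> j /negPf ->.
  move=> j vj jv.
  have -> : \sum_l (if E v l && (l != v) then K v l + K v v * al 0 l else 0) * S l j =
      (K *m Sigma) v j - K v v * S v j + K v v * \sum_l al 0 l * S l j.
    rewrite mxE (bigD1 v) //= [in RHS](bigD1 v) //= eqxx andbF mul0r add0r.
    rewrite [X in _ = _ + _ * X](bigD1 v) //= al_v mul0r add0r.
    rewrite S_N // [_ + _ - _]addrAC subrr add0r mulr_sumr -big_split /=.
    apply: eq_bigr => l lv; rewrite lv andbT.
    have [vl|nvl] := boolP (E v l); last first.
      by rewrite SK // al_supp // !mul0r mulr0 addr0.
    by rewrite S_N //; ring.
  by rewrite al_S // mulVmx // mxE [v == j]eq_sym (negPf jv) sub0r addNr.
have K'E : invmx (shear (- 1) *m Sigma *m (shear (- 1))^T) =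
    (shear 1)^T *m K *m shear 1.
  apply: mulmx1_invmx; rewrite !mulmxA -[_ *m (shear 1)^T]mulmxA.
  rewrite -[(shear _)^T *m (shear _)^T]trmx_mul shearK trmx1 mulmx1.
  rewrite -[_ *m Sigma *m K]mulmxA mulmxV // mulmx1.
  by have := shearK (- 1); rewrite opprK.
split.
- have uT c : shear c \in unitmx by case: (mulmx1_unit (shearK c)).
  by rewrite !unitmx_mul unitmx_tr !uT uS.
- by rewrite !trmx_mul trmxK Ss mulmxA.
- move=> i j; rewrite E'E shear_congr // [eliminate _ _]mxE.
  have [->|iv] := eqVneq i v.
    rewrite /= orbF => /eqP <-; rewrite eqxx.
    rewrite (mul_al_entry (j := v)); last by move=> k vk kv; rewrite S_N.
    rewrite al_quad; last by move=> k l vk vl _ _; rewrite S_N.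
    by rewrite S_N // /schur_entry; ring.
  have [->|jv] := eqVneq j v; first by rewrite (negPf iv).
  move=> ij; rewrite SE; first by rewrite /= !addr0.
  by case/predU1P: ij => [->|//].
- move=> i j; rewrite E'E K'E shear_tr_congr //.
  have [->|iv] := eqVneq i v.
    by rewrite /= orbF eq_sym al_v => jv; rewrite (Kv j) //; ring.
  have [->|jv] := eqVneq j v.
    by rewrite /= orbF al_v => jv; rewrite [K i v]KsE (Kv i) //; ring.
  rewrite negb_or => /andP[ij nij]; rewrite SK // (Kv i) // (Kv j) //.
  have [->|/al_neq0/andP[vi _]] := eqVneq (al 0 i) 0; first by ring.
  have [->|/al_neq0/andP[vj _]] := eqVneq (al 0 j) 0; first by ring.
  by rewrite v_simplicial in nij.
Qed.

(** Row [v] of the inverse is zero off the diagonal, hence so is row [v] of [Sigma]. Shearing fills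
    it with [al *m Sigma], which agrees with [S] on the neighbours by the normal equations. *)
Lemma eliminate_completion Sigma : completion E' eliminate Sigma ->
  completion E S (shear 1 *m Sigma *m (shear 1)^T).
Proof.
move=> [uS Ss SE SK]; set K := invmx Sigma in SK.
have Ks : K^T = K by rewrite trmx_inv Ss.
have SsE i j : Sigma i j = Sigma j i by rewrite [LHS]trmxE Ss.
have KsE i j : K i j = K j i by rewrite [LHS]trmxE Ks.
have Kv k : k != v -> K v k = 0.
  by move=> kv; apply: SK; rewrite E'E eqxx orbF eq_sym.
have Svv : Sigma v v = schur_entry by rewrite SE ?E'E ?eqxx // mxE eqxx.
have KS j : K v v * Sigma v j = (v == j)%:R.
  have := mulVmx uS => /matrixP/(_ v j); rewrite !mxE => <-.
  rewrite (bigD1 v) //= big1 ?addr0 // => k kv.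
  by rewrite -/K Kv // mul0r.
have Kvv : K v v != 0.
  apply/eqP => K0; have /eqP := KS v.
  by rewrite K0 mul0r eqxx eq_sym oner_eq0.
have Sv j : j != v -> Sigma v j = 0.
  move=> jv; have /eqP := KS j; rewrite [v == j]eq_sym (negPf jv) mulf_eq0 (negPf Kvv).
  by move=> /eqP.
have S_ne i j : i != v -> j != v -> E i j -> Sigma i j = S i j.
  move=> iv jv ij; rewrite SE ?E'E ?iv ?jv ?ij ?orbT // mxE.
  by rewrite (negPf iv) (negPf jv).
have S_N k l : E v k -> E v l -> k != v -> l != v -> Sigma k l = S k l.
  by move=> vk vl kv lv; apply: S_ne => //; apply: v_simplicial.
have alSv : (al *m Sigma) 0 v = 0.
  rewrite mxE big1 // => k _; have [->|kv] := eqVneq k v.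
    by rewrite al_v mul0r.
  by rewrite SsE Sv // mulr0.
have K'E : invmx (shear 1 *m Sigma *m (shear 1)^T) =
    (shear (- 1))^T *m K *m shear (- 1).
  apply: mulmx1_invmx; rewrite !mulmxA -[_ *m (shear (- 1))^T]mulmxA.
  rewrite -[(shear _)^T *m (shear _)^T]trmx_mul.
  have := shearK (- 1); rewrite opprK => ->; rewrite trmx1 mulmx1.
  by rewrite -[_ *m Sigma *m K]mulmxA mulmxV // mulmx1 shearK.
split.
- have uT c : shear c \in unitmx by case: (mulmx1_unit (shearK c)).
  by rewrite !unitmx_mul unitmx_tr !uT uS.
- by rewrite !trmx_mul trmxK Ss mulmxA.
- have Sv_new j : E v j -> j != v ->
      (shear 1 *m Sigma *m (shear 1)^T) v j = S v j.
    move=> vj jv; rewrite shear_congr // eqxx (negPf jv) Sv // mul_al_entry.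
      by rewrite al_S //=; ring.
    by move=> k vk kv; rewrite S_N.
  have sym_new : (shear 1 *m Sigma *m (shear 1)^T)^T =
      shear 1 *m Sigma *m (shear 1)^T by rewrite !trmx_mul trmxK Ss mulmxA.
  move=> i j ij; have [iv|iv] := eqVneq i v; have [jv|jv] := eqVneq j v.
  + rewrite iv jv shear_congr // eqxx alSv al_quad // Svv /schur_entry /=.
    by ring.
  + by subst i; exact: Sv_new.
  + by subst j; rewrite trmxE sym_new Sv_new 1?E_sym // -[in RHS]S_sym mxE.
  + by rewrite shear_congr // (negPf iv) (negPf jv) S_ne // /= !addr0.
- move=> i j nij; rewrite K'E shear_tr_congr //.
  have nijE : i != j by apply: contraNneq nij => ->.
  have nij' : ~~ E' i j by rewrite E'E (negPf nijE) (negPf nij) !andbF.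
  rewrite SK //.
  have [iv|iv] := eqVneq i v.
    by subst i; rewrite al_v (al_supp nij); ring.
  have [jv|jv] := eqVneq j v.
    by subst j; rewrite al_v (@al_supp i) 1?E_sym //; ring.
  rewrite (Kv i) // (Kv j) //.
  have [->|/al_neq0/andP[vi _]] := eqVneq (al 0 i) 0; first by ring.
  have [->|/al_neq0/andP[vj _]] := eqVneq (al 0 j) 0; first by ring.
  by rewrite v_simplicial in nij.
Qed.

End Elimination.

Lemma submask_sum S A (w : 'I_m -> F) j : (forall k, k \notin A -> w k = 0) ->
  \sum_k w k * submask S A k j = if j \in A then \sum_k w k * S k j else 0.
Proof.
move=> wA; case: ifPn => jA.
  apply: eq_bigr => k _; rewrite mxE jA andbT; case: ifPn => // /wA ->.
  by rewrite !mul0r.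
rewrite big1 // => k _; rewrite mxE (negPf jA) andbF.
have [->|_] := eqVneq k j; first by rewrite wA // mul0r.
by rewrite mulr0.
Qed.

Lemma submask_unitP S A : submask S A \in unitmx <->
  (forall w : 'I_m -> F, (forall k, k \notin A -> w k = 0) ->
    (forall j, j \in A -> \sum_k w k * S k j = 0) -> forall k, w k = 0).
Proof.
split=> [uA w wA wS k|inj].
  suff /matrixP/(_ 0 k) : \row_j w j = 0 by rewrite !mxE.
  apply: (row_free_inj (A := submask S A)); first by rewrite row_free_unit.
  rewrite mul0mx; apply/rowP => j; rewrite !mxE.
  under eq_bigr do rewrite mxE.
  by rewrite submask_sum //; case: ifPn => // /wS.
apply: unitmx_rker => w wA0; have wA k : k \notin A -> w 0 k = 0.
  move=> kA; have := wA0 => /rowP/(_ k); rewrite !mxE => <-.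
  rewrite (bigD1 k) //= big1 ?addr0 => [|j jk]; rewrite mxE (negPf kA) andbF.
    by rewrite eqxx mulr1.
  by rewrite (negPf jk) mulr0.
apply/rowP => k; rewrite [RHS]mxE; apply: (inj (w 0)) => // j jA.
by have := wA0 => /rowP/(_ j); rewrite !mxE submask_sum // jA.
Qed.

(** Vertices outside of [W] stay as isolated vertices, so that the matrix size is constant during
    the elimination. *)
Definition restrict_rel E W : rel 'I_m :=
  fun x y => (x == y) || [&& x \in W, y \in W & E x y].

Lemma eq_completion E E' S Sigma : E =2 E' ->
  completion E S Sigma -> completion E' S Sigma.
Proof.
by move=> EE' [uS Ss SE SK]; split=> // i j; rewrite -EE'; [exact: SE | exact: SK].
Qed.

(** The completion is the diagonal part of [S], invertible because the minors on singletons are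
    nonzero. *)
Lemma completion_discrete S : S^T = S -> (forall A, submask S A \in unitmx) ->
  exists! Sigma, completion (fun x y => x == y) S Sigma.
Proof.
move=> Ss uS; pose D : 'M[F]_m := diag_mx (\row_i S i i).
have Sii i : S i i != 0.
  apply/eqP => Sii0; have /submask_unitP inj := uS [set i].
  suff /eqP : (i == i)%:R = 0 :> F by rewrite eqxx oner_eq0.
  apply: (inj (fun k => (i == k)%:R)) => [k|j]; rewrite inE eq_sym.
    by move=> /negPf ->.
  move=> /eqP <-; rewrite (bigD1 i) //= big1 => [|k /negPf].
    by rewrite Sii0 mulr0 addr0.
  by rewrite eq_sym => ->; rewrite mul0r.
pose D' : 'M[F]_m := diag_mx (\row_i (S i i)^-1).
have DD' : D *m D' = 1%:M.
  apply/matrixP => i j; rewrite mul_diag_mx !mxE.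
  by have [->|_] := eqVneq i j; rewrite ?mulfV ?mulr0.
exists D; split.
  split.
  - by case: (mulmx1_unit DD').
  - by rewrite tr_diag_mx.
  - by move=> i j /eqP <-; rewrite !mxE eqxx.
  - by move=> i j nij; rewrite (mulmx1_invmx DD') !mxE (negPf nij).
move=> Sigma [uSi Sis SiE SiK].
(* The inverse of [Sigma] is diagonal, necessarily with nonzero entries, so [Sigma] is diagonal as
   well. *)
have diagK : Sigma *m diag_mx (\row_i invmx Sigma i i) = 1%:M.
  rewrite -(mulmxV uSi); congr (_ *m _); apply/matrixP => i j; rewrite !mxE.
  by have [->|nij] := eqVneq i j; rewrite ?mulr1n // mulr0n SiK.
apply/matrixP => i j; rewrite !mxE; have [->|nij] := eqVneq i j.
  by rewrite SiE.
have := diagK => /matrixP/(_ i j); rewrite mul_mx_diag !mxE (negPf nij) mulr0n.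
move=> /eqP; rewrite mulf_eq0 => /orP[/eqP->//|/eqP K0].
have := diagK => /matrixP/(_ j j); rewrite mul_mx_diag !mxE K0 mulr0 eqxx.
by move=> /esym/eqP; rewrite oner_eq0.
Qed.

(** Induction on [#|W|], eliminating a simplicial vertex. Nonvanishing of all principal minors is
    inherited by the eliminated data, whichever vertex comes next. *)
Lemma chordal_completion E W S : symmetric E -> reflexive E -> chordal E ->
  S^T = S -> (forall A, submask S A \in unitmx) ->
  exists! Sigma, completion (restrict_rel E W) S Sigma.
Proof.
move=> E_sym E_refl chE; have [k] := ubnP #|W|; elim: k W S => // k IH W S Wk Ss uS.
have [W0|W_neq0] := eqVneq W finset.set0.
  have [D [cD uD]] := completion_discrete Ss uS.
  have EW : restrict_rel E W =2 (fun x y => x == y).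
    by move=> x y; rewrite /restrict_rel W0 inE orbF.
  exists D; split; first by apply: eq_completion cD => x y; rewrite EW.
  by move=> Sigma /(eq_completion EW); exact: uD.
have [v vW sv] := chordal_simplicial E_sym E_refl chE W_neq0.
set EW := restrict_rel E W.
have EW_sym : symmetric EW.
  by move=> x y; rewrite /EW /restrict_rel eq_sym E_sym andbCA.
have EW_refl : reflexive EW by move=> x; rewrite /EW /restrict_rel eqxx.
have EW_s x y : EW v x -> EW v y -> EW x y.
  rewrite /EW /restrict_rel => /predU1P[<-|/and3P[_ xW vx]]; first by [].
  move=> /predU1P[<-|/and3P[_ yW vy]].
    by rewrite vW xW E_sym vx orbT.
  by rewrite xW yW sv // orbT.
set E' := restrict_rel E (W :\ v).
have E'E x y : E' x y = (x == y) || [&& x != v, y != v & EW x y].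
  rewrite /E' /EW /restrict_rel !inE; case: (x == y) => //=.
  by case: (x == v) => //=; case: (y == v) => //=; rewrite ?andbF.
pose N := [set j | EW v j && (j != v)].
have /submask_unitP N_inj := uS N.
have S_N_inj w : (forall j, ~~ (EW v j && (j != v)) -> w j = 0) ->
    (forall j, EW v j -> j != v -> \sum_k w k * S k j = 0) -> forall j, w j = 0.
  move=> wN wS; apply: N_inj => [j|j].
    by rewrite inE; exact: wN.
  by rewrite inE => /andP[]; exact: wS.
pose b : 'rV[F]_m := \row_j (if j \in N then S v j else 0).
have [al alb] : exists al : 'rV_m, al *m submask S N = b.
  by exists (b *m invmx (submask S N)); rewrite mulmxKV.
have alN j : j \notin N -> al 0 j = 0.
  move=> jN; have := alb => /rowP/(_ j); rewrite !mxE (negPf jN) => <-.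
  rewrite (bigD1 j) //= big1 ?addr0 => [|l lj]; rewrite mxE (negPf jN) andbF.
    by rewrite eqxx mulr1.
  by rewrite (negPf lj) mulr0.
have al_v : al 0 v = 0 by apply: alN; rewrite inE eqxx andbF.
have al_supp j : ~~ EW v j -> al 0 j = 0.
  by move=> nvj; apply: alN; rewrite inE (negPf nvj).
have al_S j : EW v j -> j != v -> \sum_k al 0 k * S k j = S v j.
  move=> vj jv; have jN : j \in N by rewrite inE vj.
  by have := alb => /rowP/(_ j); rewrite !mxE jN submask_sum // jN.
(* Otherwise [e_v - al] would be in the left kernel of the block of [S] on [v |: N]. *)
have d_neq0 : schur_entry v al S != 0.
  apply/eqP => d0; have /submask_unitP inj := uS (v |: N).
  suff /eqP : (v == v)%:R - al 0 v = 0 by rewrite al_v eqxx subr0 oner_eq0.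
  apply: (inj (fun k => (v == k)%:R - al 0 k)) => [j|j].
    rewrite !inE negb_or => /andP[jv jN]; rewrite eq_sym (negPf jv) alN ?subr0 //.
    by rewrite inE.
  rewrite !inE => jN; under eq_bigr do rewrite mulrBl.
  rewrite sumrB (bigD1 v) //= eqxx mul1r big1 ?addr0; last first.
    by move=> l lv; rewrite eq_sym (negPf lv) mul0r.
  have [jv|jv] := eqVneq j v; first by rewrite jv -[RHS]d0.
  by rewrite al_S ?subrr //; case/orP: jN => [/eqP vj|/andP[]//]; rewrite vj eqxx in jv.
set S' := eliminate v al S.
have S's : S'^T = S'.
  apply/matrixP => i j; rewrite !mxE; case: (i == v); case: (j == v) => //.
  by rewrite [LHS]trmxE Ss.
(* The block of [S'] on [A] splits into the block of [S] on [A :\ v] and, if [v] is in [A], the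
   nonzero Schur complement. *)
have uS' A : submask S' A \in unitmx.
  apply/submask_unitP => w wA wS.
  have /submask_unitP inj := uS (A :\ v).
  have wv : w v = 0.
    have [vA|/wA//] := boolP (v \in A).
    have := wS v vA; rewrite (bigD1 v) //= big1 ?addr0 => [|l lv].
      by move=> /eqP; rewrite mxE eqxx mulf_eq0 (negPf d_neq0) orbF => /eqP.
    by rewrite mxE (negPf lv) eqxx mulr0.
  apply: inj => [j|j].
    by rewrite !inE negb_and negbK => /predU1P[->//|]; exact: wA.
  rewrite !inE => /andP[jv jA]; rewrite -[RHS](wS j jA); apply: eq_bigr => l _.
  have [->|lv] := eqVneq l v; first by rewrite wv !mul0r.
  by rewrite mxE (negPf lv) (negPf jv).
have W'k : (#|W :\ v| < k)%N by move: Wk; rewrite (cardsD1 v W) vW.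
have [Sg [cSg uSg]] := IH _ _ W'k S's uS'.
exists (shear v al 1 *m Sg *m (shear v al 1)^T); split.
  exact: (eliminate_completion al_v EW_sym EW_refl EW_s E'E Ss al_supp al_S).
move=> Sigma cS.
have := completion_eliminate al_v EW_refl EW_s E'E Ss al_supp al_S S_N_inj cS.
move=> /uSg ->; have shK := shearK al_v 1.
rewrite !mulmxA shK mul1mx -mulmxA -trmx_mul.
by have := shearK al_v 1; rewrite /= => ->; rewrite trmx1 mulmx1.
Qed.

End Completion.

(** * Chordal graphs have ML degree one *)

Section ChordalDegree.
Local Open Scope ring_scope.
Local Open Scope classical_set_scope.
Local Open Scope card_scope.
Local Open Scope complex_scope.
Variables (R : realType) (m : nat).

Lemma critical_pointsE (E : rel 'I_m) (S : 'M[R]_m) :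
  critical_points E S = [set Sigma | completion E (map_mx (real_complex R) S) Sigma].
Proof.
by apply/seteqP; split=> Sigma [uS Ss SE SK]; split=> // i j ij;
  rewrite SE // mxE.
Qed.

Definition minor_mpoly (A : {set 'I_m}) : mpoly.mpoly (m * m) R :=
  \det (\matrix_(i, j) if (i \in A) && (j \in A)
    then mpoly.mpolyX R (mpoly.mnm1 (mxvec_index i j)) else (i == j)%:R).

Lemma mxeval_minor (A : {set 'I_m}) (S : 'M[R]_m) :
  mxeval (minor_mpoly A) S = \det (submask S A).
Proof.
rewrite /mxeval /minor_mpoly -det_map_mx; congr (\det _).
apply/matrixP => i j; rewrite !mxE; case: ifP => _.
  by rewrite /= mpoly.mevalXU mxvecE.
by rewrite rmorph_nat.
Qed.

Lemma mxeval_prod_minor (S : 'M[R]_m) :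
  mxeval (\prod_(A : {set 'I_m}) minor_mpoly A) S =
  \prod_(A : {set 'I_m}) \det (submask S A).
Proof.
rewrite /mxeval rmorph_prod; apply: eq_bigr => A _; exact: mxeval_minor.
Qed.

(** Generic means here that no principal minor vanishes; the product of the minors is 1 at the
    identity matrix. The unique completion is taken over [R[i]]. *)
Lemma chordal_has_ML_degree1 (E : rel 'I_m) :
  symmetric E -> reflexive E -> chordal E -> has_ML_degree R E 1.
Proof.
move=> E_sym E_refl chE; exists (\prod_(A : {set 'I_m}) minor_mpoly A).
  exists 1%:M; first exact: trmx1.
  rewrite mxeval_prod_minor; apply/prodf_neq0 => A _.
  suff -> : submask (1%:M : 'M[R]_m) A = 1%:M by rewrite det1 oner_neq0.
  by apply/matrixP => i j; rewrite !mxE; case: ifP.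
move=> S Ss; rewrite mxeval_prod_minor => /prodf_neq0 minorS.
set S' := map_mx (real_complex R) S.
have S's : S'^T = S' by rewrite /S' map_trmx Ss.
have uS' A : submask S' A \in unitmx.
  have -> : submask S' A = map_mx (real_complex R) (submask S A).
    by apply/matrixP => i j; rewrite !mxE; case: ifP => // _; rewrite rmorph_nat.
  by rewrite map_unitmx unitmxE unitfE minorS.
have [Sg [cSg uSg]] := chordal_completion [set: 'I_m]%SET E_sym E_refl chE S's uS'.
have ET : restrict_rel E [set: 'I_m]%SET =2 E.
  move=> x y; rewrite /restrict_rel !inE /=.
  by have [->|] := eqVneq x y; rewrite ?E_refl.
rewrite critical_pointsE.
suff -> : [set Sigma | completion E S' Sigma] = [set Sg] by exact: card_set1.
apply/seteqP; split=> [Sigma cS|_ ->]; last exact: eq_completion cSg.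
by apply/esym/uSg; apply: eq_completion cS => x y; rewrite ET.
Qed.

End ChordalDegree.

(** Combines completeness with the norm, so that the fixed point theorem for contractions applies to
    matrices. *)
HB.instance Definition _ (R : realType) p q := Complete.on 'M[R]_(p, q).

(** * The linearized completion problem *)

Section Jacobian.
Local Open Scope ring_scope.
Variables (F : comNzRingType) (m : nat).

(* The derivative, at X0 with inverse K, of the map sending X to the matrix
   with entries X i j on the edges and (X^-1) i j off the edges. *)
Definition jacobian (E : rel 'I_m) (K X : 'M[F]_m) : 'M[F]_m :=
  \matrix_(i, j) if E i j then X i j else - (K *m X *m K) i j.

Lemma jacobian_is_linear E K : linear (jacobian E K).
Proof.
move=> a X Y; apply/matrixP => i j.
have scaleE (Z : 'M[F]_m) : (a *: Z) i j = a * Z i j by rewrite mxE.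
rewrite [RHS]mxE [X in _ = X + _]mxE ![jacobian _ _ _ i j]mxE.
case: (E i j); first by rewrite !mxE.
rewrite mulmxDr mulmxDl -scalemxAr -scalemxAl [X in - X]mxE scaleE.
by rewrite opprD mulrN.
Qed.

HB.instance Definition _ E K :=
  GRing.isLinear.Build F 'M[F]_m 'M[F]_m _ (jacobian E K) (jacobian_is_linear E K).

End Jacobian.

(** * Persistence of nondegenerate completions *)

Section Perturbation.
Local Open Scope ring_scope.
Local Open Scope classical_set_scope.
Variable R : realType.

(** The center moves by at most [r / 2] and distances to it are halved, so the closed ball is mapped
    into itself and Banach's theorem applies. *)
Lemma contraction_ball (V : completeNormedModType R) (f : V -> V) x0 (r : R) :
  0 <= r ->
  (forall x y, `|x0 - x| <= r -> `|x0 - y| <= r ->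
    `|f x - f y| <= 2^-1 * `|x - y|) ->
  `|x0 - f x0| <= r / 2 -> exists2 x, `|x0 - x| <= r & f x = x.
Proof.
move=> r0 f_lip fx0; pose U : set V := closed_ball_ Num.Def.normr x0 r.
have Ux0 : U x0 by rewrite /U /closed_ball_ /= subrr normr0.
have fU : {homo f : x / U x >-> U x}.
  move=> x Ux; rewrite /U /closed_ball_ /= -(subrKA (f x0)).
  rewrite (le_trans (ler_normD _ _)) // [leRHS](splitr r) lerD //.
  rewrite (le_trans (f_lip _ _ Ux0 Ux)) // mulrC ler_pM2r ?invr_gt0 //.
have ctr : is_contraction (mkfun_fun fU).
  exists (2^-1)%:nng; split; first by rewrite /= invf_lt1 // ltr1n.
  by move=> [x y] /= [Ux Uy]; exact: f_lip.
have [x Ux fx] := banach_fixed_point ctr (@closed_closed_ball_ _ _ _ _) (ex_intro _ _ Ux0).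
by exists x => //; rewrite [RHS]fx.
Qed.

Lemma mx_entry_le p q (A : 'M[R]_(p, q)) i j : `|A i j| <= `|A|.
Proof.
rewrite [leRHS]/Num.Def.normr /= mx_normrE.
exact: (le_bigmax_cond _ (fun ij => `|A ij.1 ij.2|) (j := (i, j))).
Qed.

Lemma mx_norm_le p q (A : 'M[R]_(p, q)) c : 0 <= c ->
  (forall i j, `|A i j| <= c) -> `|A| <= c.
Proof.
by move=> c0 Ac; rewrite [leLHS]/Num.Def.normr /= mx_normrE; apply: bigmax_le => // i _.
Qed.

Lemma mx_norm_mul p q s (A : 'M[R]_(p, q)) (B : 'M[R]_(q, s)) :
  `|A *m B| <= q%:R * (`|A| * `|B|).
Proof.
apply: mx_norm_le => [|i j]; first by rewrite !mulr_ge0.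
rewrite mxE (le_trans (ler_norm_sum _ _ _)) //.
rewrite (le_trans (y := \sum_(k < q) `|A| * `|B|)) //.
  by apply: ler_sum => k _; rewrite normrM ler_pM ?mx_entry_le.
by rewrite sumr_const card_ord mulr_natl.
Qed.

Lemma linear_mx_inverse m (L : {linear 'M[R]_m -> 'M[R]_m}) :
  (forall X, L X = 0 -> X = 0) ->
  exists (G : 'M[R]_m -> 'M[R]_m) (c : R),
    [/\ 0 < c, forall Y, L (G Y) = Y, forall X, G (L X) = X,
      {morph G : Y Z / Y - Z} & forall Y, `|G Y| <= c * `|Y|].
Proof.
move=> /lin_mx_unitP; set M := lin_mx L => uM.
pose G (Y : 'M[R]_m) : 'M[R]_m := vec_mx (mxvec Y *m invmx M).
exists G, ((m * m)%:R * `|invmx M| + 1); split.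
- by rewrite ltr_wpDl // mulr_ge0.
- by move=> Y; rewrite -[LHS]mxvecK -mul_vec_lin vec_mxK mulmxKV // mxvecK.
- by move=> X; rewrite /G -mul_vec_lin mulmxK // mxvecK.
- by move=> Y Z; rewrite /G !linearB /= mulmxBl linearB.
- move=> Y; apply: mx_norm_le => [|i j].
    by rewrite mulr_ge0 // addr_ge0 // mulr_ge0.
  rewrite mxE (le_trans (mx_entry_le _ _ _)) // (le_trans (mx_norm_mul _ _)) //.
  rewrite [X in _ * X <= _]mulrC mulrA ler_pM ?mulr_ge0 //; first by rewrite lerDl.
  apply: mx_norm_le => // k l; rewrite ord1; case/mxvec_indexP: l => x y.
  by rewrite mxvecE mx_entry_le.
Qed.

(** If [w *m X = 0] then [w = w *m (X0 - X) *m invmx X0], of norm at most [|w| / 2], so [w = 0]. The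
    estimates come from [X^-1 - X0^-1 = X^-1 (X0 - X) X0^-1]. *)
Lemma invmx_near m (X0 : 'M[R]_m) : X0 \in unitmx ->
  exists C r : R, [/\ 0 < C, 0 < r &
    forall X, `|X0 - X| <= r -> [/\ X \in unitmx, `|invmx X| <= C &
      `|invmx X - invmx X0| <= C * `|X0 - X|]].
Proof.
(* The max norm is submultiplicative only up to the factor [m]. Adding 1 keeps [M] and [k] positive,
   also for [m = 0]. *)
move=> uX0; pose k := `|invmx X0| + 1; pose M : R := m%:R + 1.
have k1 : 1 <= k by rewrite lerDr.
have M1 : 1 <= M by rewrite lerDr.
have k0 : 0 < k by exact: lt_le_trans k1.
have M0 : 0 < M by exact: lt_le_trans M1.
have mulM p (A : 'M[R]_(p, m)) (B : 'M[R]_m) : `|A *m B| <= M * (`|A| * `|B|).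
  by rewrite (le_trans (mx_norm_mul _ _)) // ler_wpM2r ?mulr_ge0 // lerDl.
have mulM2 p (A : 'M[R]_(p, m)) (B C : 'M[R]_m) a b c :
    `|A| <= a -> `|B| <= b -> `|C| <= c -> `|A *m B *m C| <= M ^+ 2 * (a * b * c).
  move=> Aa Bb Cc; rewrite (le_trans (mulM _ _ _)) // expr2 -mulrA ler_pM2l //.
  rewrite (le_trans (y := M * (`|A| * `|B|) * `|C|)) ?ler_wpM2r //.
  by rewrite -mulrA ler_pM2l // !ler_pM // mulr_ge0.
pose C := 2 * M ^+ 2 * k ^+ 2; pose r := (2 * M ^+ 2 * k)^-1.
have r0 : 0 < r by rewrite invr_gt0 !mulr_gt0 // exprn_gt0.
have rE : M ^+ 2 * r * k = 2^-1 by rewrite /r; field; rewrite !gt_eqF.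
have K0k : `|invmx X0| <= k by rewrite lerDl.
exists C, r; split => // [|X Xr]; first by rewrite !mulr_gt0 // exprn_gt0.
have uX : X \in unitmx.
  apply: unitmx_rker => w wX.
  have wE : w = w *m (X0 - X) *m invmx X0 by rewrite mulmxBr wX subr0 mulmxK.
  have := mulM2 _ w (X0 - X) (invmx X0) _ _ _ (lexx _) Xr K0k.
  rewrite -wE; have -> : M ^+ 2 * (`|w| * r * k) = `|w| * (M ^+ 2 * r * k) by ring.
  rewrite rE => wle; apply/eqP; rewrite -normr_eq0 eq_le normr_ge0 andbT.
  by lra.
have dK : invmx X - invmx X0 = invmx X *m (X0 - X) *m invmx X0.
  by rewrite mulmxBr mulmxBl mulVmx // mul1mx mulmxK.
have Xk : `|invmx X| <= 2 * k.
  have := mulM2 _ (invmx X) (X0 - X) (invmx X0) _ _ _ (lexx _) Xr K0k.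
  rewrite -dK; have -> : M ^+ 2 * (`|invmx X| * r * k) = `|invmx X| * (M ^+ 2 * r * k).
    by ring.
  rewrite rE => dle; have := ler_normD (invmx X - invmx X0) (invmx X0).
  by rewrite subrK; lra.
have M21 : 1 <= M ^+ 2 by rewrite exprn_ege1.
split=> //.
  rewrite (le_trans Xk) // /C -mulrA ler_pM2l // expr2 mulrA ler_peMl ?(ltW k0) //.
  by rewrite mulr_ege1.
rewrite dK (le_trans (mulM2 _ _ _ _ _ _ _ Xk (lexx _) K0k)) //.
by rewrite /C le_eqVlt; apply/orP; left; apply/eqP; ring.
Qed.

Lemma mxBE m (A B : 'M[R]_m) i j : (A - B) i j = A i j - B i j.
Proof. by rewrite !mxE. Qed.

Lemma mxNE m (A : 'M[R]_m) i j : (- A) i j = - A i j.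
Proof. by rewrite mxE. Qed.

(** An implicit function theorem at [X0]. All [m * m] entries are treated as unknowns; the solution
    is symmetric because its transpose is a solution in the same ball, where solutions are
    unique. *)
Lemma completion_perturb m (E : rel 'I_m) (S0 X0 : 'M[R]_m) (eps : R) :
  symmetric E -> completion E S0 X0 ->
  (forall X, jacobian E (invmx X0) X = 0 -> X = 0) -> 0 < eps ->
  exists2 eta, 0 < eta & forall S : 'M[R]_m, S^T = S -> `|S0 - S| <= eta ->
    exists2 X, completion E S X & `|X0 - X| <= eps.
Proof.
move=> E_sym [uX0 X0s X0E X0K] /linear_mx_inverse[G [c [c0 LG GL GB Gc]]] eps0.
set K0 := invmx X0 in LG GL X0K.
have [C [r1 [C0 r10 near]]] := invmx_near uX0.
pose M : R := m%:R ^+ 2.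
have M0 : 0 <= M by rewrite exprn_ge0.
have mul2 (A B D : 'M[R]_m) : `|A *m B *m D| <= M * (`|A| * `|B| * `|D|).
  rewrite (le_trans (mx_norm_mul _ _)) // /M expr2 -mulrA ler_wpM2l //.
  by rewrite mulrA ler_wpM2r // mx_norm_mul.
pose k : R := `|K0|; pose Q : R := c * (M * (C * (C + k))).
have C0' := ltW C0; have c0' := ltW c0.
have k0 : 0 <= k by exact: normr_ge0.
have Q0 : 0 <= Q by rewrite /Q !mulr_ge0 ?addr_ge0.
(* The bounds ensure closeness to [X0], control of the inverse, and the contraction factor
   [Q * r <= 1 / 2]. *)
pose r := Num.min eps (Num.min r1 (2 * (Q + 1))^-1).
have r0 : 0 < r by rewrite !lt_min eps0 r10 invr_gt0 mulr_gt0 // ltr_wpDl.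
have r_eps : r <= eps by rewrite /r ge_min lexx.
have r_r1 : r <= r1 by rewrite /r !ge_min lexx orbT.
have r_Q : Q * r <= 2^-1.
  have rQ1 : r <= (2 * (Q + 1))^-1 by rewrite /r !ge_min lexx !orbT.
  rewrite (le_trans (ler_wpM2l Q0 rQ1)) // ler_pdivrMr ?mulr_gt0 ?ltr_wpDl //.
  by rewrite mulrA mulVf ?mul1r ?lerDl ?pnatr_eq0.
(* With this bound the first step [G (Phi X0)] has norm at most [r / 2]. *)
exists (r / (2 * c)) => [|S Ss S0S]; first by rewrite divr_gt0 ?mulr_gt0.
pose Phi (X : 'M[R]_m) : 'M[R]_m :=
  \matrix_(i, j) if E i j then X i j - S i j else invmx X i j.
have r0' := ltW r0.
(* Simplified Newton iteration for Phi X = 0. *)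
pose T X := X - G (Phi X).
have T_lip X Y : `|X0 - X| <= r -> `|X0 - Y| <= r ->
    `|T X - T Y| <= 2^-1 * `|X - Y|.
  move=> Xr Yr; have [uX Xk dX] := near X (le_trans Xr r_r1).
  have [uY Yk dY] := near Y (le_trans Yr r_r1).
  pose D := X - Y.
  (* As [G] inverts the Jacobian at [X0], only the linearization error of [Phi] remains. *)
  have -> : T X - T Y = G (jacobian E K0 D - (Phi X - Phi Y)).
    by rewrite /T /D GB GL GB !opprD !opprK addrACA.
  have bound : `|jacobian E K0 D - (Phi X - Phi Y)| <= M * (C * (C + k)) * r * `|D|.
    have -> : M * (C * (C + k)) * r * `|D| =
        M * (C * r * `|D| * C) + M * (k * `|D| * (C * r)) by ring.
    have MCr : 0 <= M * (C * r * `|D| * C) + M * (k * `|D| * (C * r)).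
      by rewrite addr_ge0 // !mulr_ge0.
    apply: mx_norm_le => // i j.
    rewrite !mxBE [jacobian _ _ _ i j]mxE [Phi X i j]mxE [Phi Y i j]mxE.
    case: (E i j).
      by rewrite (_ : _ - _ = 0) ?normr0 // /D mxBE; ring.
    have XYK : invmx X - invmx Y = - (invmx X *m D *m invmx Y).
      by rewrite /D mulmxBr mulmxBl mulVmx // mul1mx mulmxK // opprB.
    (* The two factors [K0] are exchanged one at a time. *)
    have -> : - (K0 *m D *m K0) i j - (invmx X i j - invmx Y i j) =
        ((invmx X - K0) *m D *m invmx Y + K0 *m D *m (invmx Y - K0)) i j.
      have := XYK => /matrixP/(_ i j); rewrite mxBE => ->.
      rewrite !mulmxBl [K0 *m D *m (_ - _)]mulmxBr addrA subrK mxBE mxNE.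
      by rewrite opprK addrC.
    rewrite (le_trans (mx_entry_le _ _ _)) // (le_trans (ler_normD _ _)) //.
    rewrite lerD // (le_trans (mul2 _ _ _)) // ler_wpM2l //.
      by rewrite !ler_pM ?mulr_ge0 // (le_trans dX) // ler_pM2l.
    by rewrite ler_pM ?mulr_ge0 // (le_trans dY) // ler_pM2l.
  rewrite (le_trans (Gc _)) // (le_trans (ler_wpM2l (ltW c0) bound)) //.
  have -> : c * (M * (C * (C + k)) * r * `|D|) = Q * r * `|D| by rewrite /Q; ring.
  by rewrite ler_wpM2r.
have T0 : `|X0 - T X0| <= r / 2.
  rewrite /T opprB addrC subrK (le_trans (Gc _)) // mulrC -ler_pdivlMr //.
  rewrite -mulrA -invfM (le_trans _ S0S) //.
  apply: mx_norm_le => // i j; rewrite mxE; case: ifPn => ij.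
    by rewrite X0E // (le_trans _ (mx_entry_le _ i j)) // !mxE.
  by rewrite X0K // normr0.
have [X Xr TX] := contraction_ball (ltW r0) T_lip T0.
have [uX _ _] := near X (le_trans Xr r_r1).
have Phi0 : Phi X = 0.
  rewrite -[Phi X]LG; have -> : G (Phi X) = 0.
    by rewrite -[LHS](subKr X) -/(T X) TX subrr.
  exact: linear0.
have XE i j : E i j -> X i j = S i j.
  by move=> ij; have := Phi0 => /matrixP/(_ i j); rewrite !mxE ij => /subr0_eq.
have XK i j : ~~ E i j -> invmx X i j = 0.
  by move=> ij; have := Phi0 => /matrixP/(_ i j); rewrite !mxE (negPf ij).
exists X; last exact: le_trans r_eps.
split=> //.
have trT : `|X0 - X^T| <= r.
  rewrite -X0s -linearB /=; apply: mx_norm_le => [|i j]; first exact: ltW.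
  by rewrite mxE (le_trans (mx_entry_le _ _ _)).
have TXt : T X^T = X^T.
  rewrite /T; have -> : Phi X^T = 0.
    apply/matrixP => i j; rewrite [LHS]mxE -trmx_inv !mxE E_sym.
    case: ifPn => ji.
      by rewrite XE // [S i j]trmxE Ss subrr.
    by rewrite XK.
  by rewrite -[0](linear0 (jacobian E K0)) GL subr0.
have := T_lip _ _ trT Xr; rewrite TXt TX => le_half.
apply/eqP; rewrite -subr_eq0 -normr_eq0 eq_le normr_ge0 andbT.
by move: le_half (normr_ge0 (X^T - X)); lra.
Qed.

End Perturbation.

(** * Two nondegenerate completions exclude ML degree one *)

Section TwoCompletions.
Local Open Scope ring_scope.
Local Open Scope classical_set_scope.
Local Open Scope card_scope.
Variables (R : realType) (m : nat).

(** The [size p] distinct points [d / (k + 1)] cannot all be roots. *)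
Lemma poly_nonroot_near0 (p : {poly R}) (d : R) : p != 0 -> 0 < d ->
  exists2 t, 0 < t <= d & p.[t] != 0.
Proof.
move=> p0 d0; pose s : seq R := [seq d / k.+1%:R | k <- iota 0 (size p)].
have us : uniq s.
  rewrite map_inj_uniq ?iota_uniq // => x y /(mulfI (lt0r_neq0 d0))/invr_inj/eqP.
  by rewrite eqr_nat => /eqP[].
have : ~~ all (root p) s.
  apply/negP => rs; have := max_poly_roots p0 rs us.
  by rewrite size_map size_iota ltnn.
move=> /allPn[t /mapP[k _ ->]]; rewrite rootE => pt; exists (d / k.+1%:R) => //.
by rewrite divr_gt0 //= ler_pdivrMr // ler_peMr ?ler1n // ltW.
Qed.

Lemma card_eq1_inj (T : Type) (A : set T) : A #= `I_1 ->
  forall x y, A x -> A y -> x = y.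
Proof.
move=> /card_bijP[f /bij_inj f_inj] x y Ax Ay.
have f0 z : val (f z) = 0%N.
  by have := set_mem (valP (f z)); rewrite /= ltnS leqn0 => /eqP.
have := f_inj (SigSub (mem_set Ax)) (SigSub (mem_set Ay)) _.
by move=> /(_ (val_inj (etrans (f0 _) (esym (f0 _)))))/(congr1 val).
Qed.

Lemma completion_map (E : rel 'I_m) (S X : 'M[R]_m) : completion E S X ->
  completion E (map_mx (real_complex R) S) (map_mx (real_complex R) X).
Proof.
move=> [uX Xs XE XK]; split.
- by rewrite map_unitmx.
- by rewrite map_trmx Xs.
- by move=> i j ij; rewrite !mxE XE.
- by move=> i j ij; rewrite -map_invmx mxE XK // rmorph0.
Qed.

(** On the line from [S0] to a point where [f] is nonzero, there are points arbitrarily near [S0]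
    where [f] is nonzero. There the completions near [X1] and [X2] survive, and moving each by at
    most a third of [|X1 - X2|] keeps them distinct. *)
Lemma two_completions_ML_degree (E : rel 'I_m) (S0 X1 X2 : 'M[R]_m) :
  symmetric E -> S0^T = S0 -> X1 != X2 ->
  completion E S0 X1 -> completion E S0 X2 ->
  (forall X, jacobian E (invmx X1) X = 0 -> X = 0) ->
  (forall X, jacobian E (invmx X2) X = 0 -> X = 0) ->
  ~ has_ML_degree R E 1.
Proof.
move=> E_sym S0s X12 c1 c2 J1 J2 [f [S1 S1s fS1] fP].
pose eps := `|X1 - X2| / 3.
have nX : 0 < `|X1 - X2| by rewrite normr_gt0 subr_eq0.
have eps0 : 0 < eps by rewrite divr_gt0.
have [eta1 e1 near1] := completion_perturb E_sym c1 J1 eps0.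
have [eta2 e2 near2] := completion_perturb E_sym c2 J2 eps0.
have [p pE] := mxeval_line f S0 S1.
have p0 : p != 0.
  apply: contra_neq fS1 => p0.
  by have := pE 1; rewrite p0 horner0 scale1r addrC subrK.
pose d := Num.min eta1 eta2 / (`|S1 - S0| + 1).
have n1 : 0 < `|S1 - S0| + 1 by rewrite ltr_wpDl.
have min0 : 0 < Num.min eta1 eta2 by rewrite lt_min e1.
have [t /andP[t0 td] pt] := poly_nonroot_near0 p0 (divr_gt0 min0 n1).
pose S := S0 + t *: (S1 - S0).
have Ss : S^T = S by rewrite linearD linearZ /= linearB /= S0s S1s.
have S0S : `|S0 - S| <= Num.min eta1 eta2.
  rewrite /S opprD addrA subrr add0r normrN mx_normZ gtr0_norm //.
  rewrite (le_trans (y := t * (`|S1 - S0| + 1))) //.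
    by rewrite ler_pM2l // lerDl.
  by rewrite -ler_pdivlMr.
have [|Y1 cY1 XY1] := near1 S Ss.
  by rewrite (le_trans S0S) // ge_min lexx.
have [|Y2 cY2 XY2] := near2 S Ss.
  by rewrite (le_trans S0S) // ge_min lexx orbT.
have fS : mxeval f S != 0 by rewrite -pE.
have := fP S Ss fS; rewrite critical_pointsE => /card_eq1_inj one.
have Y12 : Y1 = Y2.
  apply/matrixP => i j.
  have := one _ _ (completion_map cY1) (completion_map cY2) => /matrixP/(_ i j).
  by rewrite !mxE => -[].
have : `|X1 - X2| <= eps + eps.
  rewrite -(subrKA Y1) (le_trans (ler_normD _ _)) // lerD //.
  by rewrite Y12 distrC.
by rewrite /eps; lra.
Qed.

End TwoCompletions.

(** * Two angles with the same ratio of cosines *)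

Section Trigonometry.
Local Open Scope classical_set_scope.
Local Open Scope ring_scope.
Variable R : realType.

Lemma exists_gt1_notin (s : seq R) : exists2 x, 1 < x & x \notin s.
Proof.
set t := \sum_(y <- s) `|y|.
have t0 : 0 <= t by rewrite sumr_ge0.
exists (2 + t); first by lra.
apply/negP => ts; have : 2 + t <= t.
  rewrite {2}/t (big_rem _ ts) /= (le_trans (ler_norm _)) // lerDl.
  by rewrite sumr_ge0.
by lra.
Qed.

(** The function [h] is negative at 0, positive at [pi / (2 n)] and negative at [3 pi / (2 n)],
    since [cos (n t)] vanishes at the last two. This gives one zero strictly inside each interval,
    and [n >= 4] puts both below [pi / 2]. *)
Lemma cos_ratio_pair (n : nat) (x : R) : (4 <= n)%N -> 1 < x ->
  exists a b : R, [/\ 0 < a, a < b, b < pi / 2,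
    (cos (n%:R * a) != 0) && (cos (n%:R * b) != 0) &
    cos ((n%:R - 2) * a) = x * cos (n%:R * a) /\
    cos ((n%:R - 2) * b) = x * cos (n%:R * b)].
Proof.
move=> n4 x1; have pi0 := pi_gt0 R.
have n4R : 4 <= n%:R :> R by rewrite ler_nat.
have n0 : 0 < n%:R :> R by lra.
pose h (t : R) := cos ((n%:R - 2) * t) - x * cos (n%:R * t).
have h_cont a b : {within `[a, b], continuous h}.
  have cos_lin (c : R) : continuous (fun t => cos (c * t)).
    move=> t; apply: (@continuous_comp _ _ _ (fun t => c * t) (@cos R)).
      exact: mulrl_continuous.
    exact: continuous_cos.
  apply: continuous_subspaceT => t; apply: cvgB; first exact: cos_lin.
  by apply: cvgMr; exact: cos_lin.
pose p1 : R := pi / (2 * n%:R); pose p2 : R := 3 * p1.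
have p10 : 0 < p1 by rewrite divr_gt0 // mulr_gt0.
have np1 : n%:R * p1 = pi / 2 by rewrite /p1; field; rewrite gt_eqF.
have np2 : n%:R * p2 = pi / 2 + pi by rewrite /p2 mulrCA np1; field.
have p14 : 4 * p1 <= pi / 2 by rewrite -np1 ler_wpM2r // ltW.
have cosneg (t : R) : pi / 2 < t < pi / 2 + pi -> cos t < 0.
  move=> t_in; rewrite -(subrK pi t) cosDpi oppr_lt0 cos_gt0_pihalf //; lra.
have h0 : h 0 < 0 by rewrite /h !mulr0 cos0 mulr1 subr_lt0.
have h1 : 0 < h p1.
  rewrite /h np1 cos_pihalf mulr0 subr0 mulrBl np1 cos_gt0_pihalf //; lra.
have h2 : h p2 < 0.
  rewrite /h np2 cosDpi cos_pihalf oppr0 mulr0 subr0 mulrBl np2 cosneg //.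
  rewrite /p2; lra.
have [a a_in ha] : exists2 a, a \in `[0, p1] & h a = 0.
  apply: IVT; [exact: ltW | exact: h_cont |].
  by rewrite minEle maxEle (ltW (lt_trans h0 h1)) !ltW.
have [b b_in hb] : exists2 b, b \in `[p1, p2] & h b = 0.
  apply: IVT; [by rewrite /p2; lra | exact: h_cont |].
  by rewrite minElt maxElt ltNge (ltW (lt_trans h2 h1)) /= !ltW.
move: a_in b_in; rewrite !in_itv /= => /andP[a0 a1] /andP[b1 b2].
have {}a0 : 0 < a.
  rewrite lt_neqAle a0 andbT; apply/eqP => aE; move: ha; rewrite -aE.
  by apply/eqP; rewrite lt_eqF.
have {}a1 : a < p1.
  rewrite lt_neqAle a1 andbT; apply/eqP => aE; move: ha; rewrite aE.
  by apply/eqP; rewrite gt_eqF.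
have {}b1 : p1 < b.
  rewrite lt_neqAle b1 andbT; apply/eqP => bE; move: hb; rewrite -bE.
  by apply/eqP; rewrite gt_eqF.
have {}b2 : b < p2.
  rewrite lt_neqAle b2 andbT; apply/eqP => bE; move: hb; rewrite bE.
  by apply/eqP; rewrite lt_eqF.
exists a, b; split=> //; first exact: lt_trans b1.
- by rewrite (lt_le_trans b2) // /p2; lra.
- apply/andP; split.
    rewrite gt_eqF // cos_gt0_pihalf // -np1 ltr_pM2l // a1 andbT.
    by rewrite (lt_trans (y := 0)) ?mulr_gt0 // oppr_lt0 mulr_gt0.
  by rewrite lt_eqF // cosneg // -np2 -np1 !ltr_pM2l // b1.
- by split; apply/eqP; rewrite -subr_eq0; apply/eqP.
Qed.

End Trigonometry.

(** * The matrix of a cycle and its inverse *)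

Section Cycle.
Local Open Scope classical_set_scope.
Local Open Scope ring_scope.
Variables (m : nat) (c : seq 'I_m).
Hypothesis c_uniq : uniq c.
Hypothesis c_size : (4 <= size c)%N.

Lemma index_next x : x \in c -> index (next c x) c =
  if (index x c).+1 == size c then 0%N else (index x c).+1.
Proof.
rewrite next_nth => xc; rewrite xc; case: c c_uniq xc => // y p up xp.
have ip : (index x (y :: p) <= size p)%N.
  by rewrite -ltnS (index_mem x (y :: p)).
case: ifP => [/eqP ie|ie].
  by rewrite (succn_inj ie) nth_default // /= eqxx.
have ip' : (index x (y :: p) < size p)%N.
  by rewrite ltn_neqAle ip andbT; apply: contraFneq ie => ->.
by rewrite -[nth y p _]/(nth y (y :: p) _.+1) index_uniq.
Qed.

Lemma index_prev x : x \in c -> index (prev c x) c =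
  if index x c == 0%N then (size c).-1 else (index x c).-1.
Proof.
move=> xc; have pc : prev c x \in c by rewrite mem_prev.
have := index_next pc; rewrite next_prev // => ->.
have := index_mem (prev c x) c; rewrite pc.
by case: ((index (prev c x) c).+1 =P size c) => /=; lia.
Qed.

Lemma next_neq_prev x : x \in c -> next c x != prev c x.
Proof.
move=> xc; apply: contraTneq c_size => /(congr1 (index^~ c)).
rewrite index_next // index_prev //; have := index_mem x c; rewrite xc.
by do 2!case: eqP; lia.
Qed.

Lemma next_neq x : x \in c -> next c x != x.
Proof.
move=> xc; apply: contraTneq c_size => /(congr1 (index^~ c)).
rewrite index_next //; have := index_mem x c; rewrite xc.
by case: eqP; lia.
Qed.

Definition cycle_adj : rel 'I_m := fun x y =>
  [&& x \in c, y \in c & (y == next c x) || (x == next c y)].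

Lemma cycle_adjE x y : x \in c ->
  cycle_adj x y = (y == next c x) || (y == prev c x).
Proof.
move=> xc; rewrite /cycle_adj xc /=.
have -> : (x == next c y) = (y == prev c x).
  by apply/eqP/eqP => ->; rewrite ?prev_next ?next_prev.
apply/andb_idl => /orP[]/eqP->; by rewrite ?mem_next ?mem_prev.
Qed.

Lemma cycle_adj_sym : symmetric cycle_adj.
Proof. by move=> x y; rewrite /cycle_adj andbCA orbC. Qed.

Lemma cycle_adj_irr x : cycle_adj x x = false.
Proof.
rewrite /cycle_adj; case: (boolP (x \in c)) => //= xc.
by rewrite orbb eq_sym; apply/negbTE/next_neq.
Qed.

(** Defined over any commutative ring, so that [s] can be a real number or the indeterminate of
    [{poly R}]. *)
Definition cycle_mx (F : comNzRingType) (s : F) : 'M[F]_m :=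
  1%:M - s *: (\matrix_(x, y) (cycle_adj x y)%:R).

Lemma cycle_mx_entry (F : comNzRingType) (s : F) x y :
  cycle_mx s x y = (x == y)%:R - s * (cycle_adj x y)%:R.
Proof. by rewrite !mxE. Qed.

Lemma tr_cycle_mx (F : comNzRingType) (s : F) : (cycle_mx s)^T = cycle_mx s.
Proof.
by apply/matrixP => x y; rewrite mxE !cycle_mx_entry eq_sym cycle_adj_sym.
Qed.

Lemma cycle_mx_mul (F : comNzRingType) (s : F) (X : 'M[F]_m) x y : x \in c ->
  (cycle_mx s *m X) x y = X x y - s * (X (next c x) y + X (prev c x) y).
Proof.
move=> xc; rewrite /cycle_mx mulmxBl mul1mx -scalemxAl 2![in LHS]mxE.
congr (_ - _); rewrite mxE; congr (_ * _); rewrite mxE.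
rewrite (bigD1 (next c x)) //= (bigD1 (prev c x)) /=; last first.
  by rewrite eq_sym next_neq_prev.
rewrite !mxE !cycle_adjE // !eqxx orbT !mul1r big1 ?addr0 // => z /andP[zn zp].
by rewrite mxE cycle_adjE // (negPf zn) (negPf zp) mul0r.
Qed.

Lemma cycle_mx_mul_out (F : comNzRingType) (s : F) (X : 'M[F]_m) x y :
  x \notin c -> (cycle_mx s *m X) x y = X x y.
Proof.
move=> xc; rewrite /cycle_mx mulmxBl mul1mx -scalemxAl 2![in LHS]mxE.
rewrite [X in _ - X]mxE [X in _ * X]mxE big1 ?mulr0 ?subr0 // => z _.
by rewrite mxE /cycle_adj (negPf xc) mul0r.
Qed.

Section Wave.
Variables (R : realType) (a : R).

(* For k = 0 .. n these are the values of a solution of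
   w (k - 1) + w (k + 1) = 2 cos (2 a) w k that is symmetric under k |-> n - k. *)
Definition wave_entry (k : nat) : R := cos (((2 * k)%:R - (size c)%:R) * a).

Lemma wave_entry_sym k : (k <= size c)%N ->
  wave_entry (size c - k) = wave_entry k.
Proof.
move=> kn; rewrite /wave_entry -cosN -mulNr; congr (cos (_ * _)).
by rewrite natrM natrB // natrM; ring.
Qed.

Lemma wave_entry_rec k :
  wave_entry k + wave_entry k.+2 = 2 * cos (2 * a) * wave_entry k.+1.
Proof.
rewrite /wave_entry; set t := ((2 * k.+1)%:R - _) * a.
have -> : ((2 * k)%:R - (size c)%:R) * a = t - 2 * a by rewrite /t; ring.
have -> : ((2 * k.+2)%:R - (size c)%:R) * a = t + 2 * a by rewrite /t; ring.
by rewrite cosB cosD; ring.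
Qed.

(** The sum of truncated differences is the distance of the indices. By [wave_entry_sym], measuring
    around the other side of the cycle gives the same entry. *)
Definition wave_mx : 'M[R]_m := \matrix_(x, y)
  if (x \in c) && (y \in c) then
    wave_entry ((index x c - index y c) + (index y c - index x c)) / wave_entry 0
  else (x == y)%:R.

Let ratio : R := wave_entry 1 / wave_entry 0.

(** Off the diagonal this is the recurrence [wave_entry_rec]. On the diagonal both neighbours are at
    distance 1 around the cycle, so the recurrence breaks there. *)
Lemma wave_mx_step x y : x \in c -> y \in c ->
  wave_mx (next c x) y + wave_mx (prev c x) y =
  if x == y then 2 * ratio else 2 * cos (2 * a) * wave_mx x y.
Proof.
move=> xc yc; rewrite !mxE mem_next mem_prev xc yc /=.
rewrite index_next // index_prev // /ratio.
have -> : (x == y) = (index x c == index y c).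
  by apply/eqP/eqP => [->//|e]; rewrite -(nth_index x xc) e nth_index.
move: (xc) (yc); rewrite -!index_mem.
move: (index x c) (index y c) => i j ilt jlt; rewrite -mulrDl.
(* Covers the places where [next] or [prev] wraps around the end of the list. *)
have wn k l : (k + l = size c)%N -> wave_entry k = wave_entry l.
  by move=> kl; rewrite -(@wave_entry_sym l); [congr wave_entry | ]; lia.
move: c_size ilt jlt wn; move: (size c) => n n4 ilt jlt wn.
case: (ltngtP i j) => ij.
- rewrite mulrA -[in RHS](_ : (j - i).-1.+1 = i - j + (j - i))%N; last by lia.
  rewrite -wave_entry_rec; congr ((_ + _) / _).
    by congr wave_entry; case: eqP; lia.
  by case: eqP => i0; [apply: wn | congr wave_entry]; lia.
- rewrite mulrA -[in RHS](_ : (i - j).-1.+1 = i - j + (j - i))%N; last by lia.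
  rewrite -wave_entry_rec addrC; congr ((_ + _) / _).
    by congr wave_entry; case: eqP; lia.
  by case: eqP => i0; [apply: wn | congr wave_entry]; lia.
- rewrite mulrA (_ : 2 * wave_entry 1 = wave_entry 1 + wave_entry 1); last by ring.
  congr ((_ + _) / _).
    by case: eqP => i0; [apply: wn | congr wave_entry]; lia.
  by case: eqP => i0; [apply: wn | congr wave_entry]; lia.
Qed.

Hypothesis wave0 : wave_entry 0 != 0.

Lemma wave_mx_diag x : wave_mx x x = 1.
Proof. by rewrite mxE eqxx subnn; case: ifP => // _; rewrite mulfV. Qed.

Lemma wave_mx_next x : x \in c -> wave_mx x (next c x) = ratio.
Proof.
move=> xc; rewrite mxE mem_next xc /= index_next //; congr (_ / _).
have := index_mem x c; rewrite xc => ilt.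
case: eqP => i0; last by congr wave_entry; lia.
by rewrite -[RHS](@wave_entry_sym 1); [congr wave_entry | ]; lia.
Qed.

Lemma tr_wave_mx : wave_mx^T = wave_mx.
Proof. by apply/matrixP => x y; rewrite !mxE andbC eq_sym addnC. Qed.

Lemma wave_mx_adj x y : cycle_adj x y -> wave_mx x y = ratio.
Proof.
move=> /and3P[xc yc /orP[]/eqP->]; first exact: wave_mx_next.
by rewrite -tr_wave_mx mxE wave_mx_next.
Qed.

Definition scaled_id (k : R) : 'M[R]_m :=
  diag_mx (\row_x if x \in c then k else 1).

(** By the choice of [s], the recurrence cancels all entries off the diagonal. *)
Lemma cycle_mx_wave s : s * (2 * cos (2 * a)) = 1 ->
  cycle_mx s *m wave_mx = scaled_id (1 - 2 * s * ratio).
Proof.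
move=> sa; apply/matrixP => x y; rewrite [RHS]mxE [in RHS]mxE.
have [xc|xc] := boolP (x \in c); last first.
  by rewrite cycle_mx_mul_out // mxE (negPf xc).
rewrite cycle_mx_mul //; have [yc|yc] := boolP (y \in c); last first.
  rewrite !mxE mem_next mem_prev xc (negPf yc) /=.
  have ne z : z \in c -> (z == y) = false by move=> zc; apply: contraNF yc => /eqP <-.
  by rewrite !ne ?mem_next ?mem_prev // addr0 mulr0 subr0 mulr0n.
rewrite wave_mx_step //; have [<-|_] := eqVneq x y.
  by rewrite wave_mx_diag mulr1n; ring.
by rewrite mulrA sa mul1r subrr mulr0n.
Qed.

End Wave.
End Cycle.

(** * Graphs with a chordless cycle *)

Section ChordlessCycle.
Local Open Scope classical_set_scope.
Local Open Scope ring_scope.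
Variables (R : realType) (m : nat) (E : rel 'I_m) (c : seq 'I_m).
Hypotheses (E_sym : symmetric E) (E_refl : reflexive E).
Hypothesis c_uniq : uniq c.
Hypothesis c_size : (4 <= size c)%N.
Hypothesis c_chordless : {in c &, forall x y, E x y = (x == y) || cycle_adj c x y}.

Lemma scaled_idM (k l : R) : scaled_id c k *m scaled_id c l = scaled_id c (k * l).
Proof.
apply/matrixP => x y; rewrite mul_diag_mx !mxE.
by case: (x \in c); rewrite mulrnAr ?mulr1.
Qed.

Lemma scaled_id1 : scaled_id c (1 : R) = 1%:M.
Proof. by apply/matrixP => x y; rewrite !mxE if_same. Qed.

(** [W] serves as its own data, so only the zeros of its inverse matter. If [k] were 0, the
    invertible cycle matrix would kill a column of [W] with diagonal entry 1. *)
Lemma completion_cycle (s k : R) (W : 'M[R]_m) : (0 < size c)%N ->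
  cycle_mx c s \in unitmx -> W^T = W -> (forall x, W x x = 1) ->
  cycle_mx c s *m W = scaled_id c k ->
  [/\ k != 0, completion E W W & invmx W = scaled_id c k^-1 *m cycle_mx c s].
Proof.
move=> c0 uK Ws W1 KW.
have k0 : k != 0.
  apply/eqP => kE; have [x xc] : exists x, x \in c.
    by case: (c) c0 => // x p _; exists x; rewrite mem_head.
  have Wx0 : col x W = 0.
    apply: (can_inj (mulKmx uK)); rewrite mulmx0 colE mulmxA KW kE -colE.
    by apply/colP => y; rewrite !mxE; have [->|] := eqVneq y x; rewrite ?xc.
  have := Wx0 => /colP/(_ x); rewrite !mxE W1; apply/eqP/oner_neq0.
have inv : scaled_id c k^-1 *m cycle_mx c s *m W = 1%:M.
  by rewrite -mulmxA KW scaled_idM mulVf // scaled_id1.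
have invE : invmx W = scaled_id c k^-1 *m cycle_mx c s.
  by apply: mulmx1_invmx; apply: mulmx1C.
split=> //; split => //.
- by case: (mulmx1_unit inv).
- move=> x y nxy; rewrite invE mul_diag_mx mxE cycle_mx_entry.
  have -> : (x == y) = false by apply: contraNF nxy => /eqP <-.
  suff -> : cycle_adj c x y = false by rewrite mulr0 subr0 mulr0.
  apply: contraNF nxy => axy; have /and3P[xc yc _] := axy.
  by rewrite c_chordless // axy orbT.
Qed.

(** With [D] the invertible diagonal factor and [K] the cycle matrix, [invmx W] is [D K] and, by
    symmetry, [K D]. So [D K X K D] and [K X K] vanish at the same entries. *)
Lemma jacobian_scaled (s k : R) (W : 'M[R]_m) : W^T = W -> k != 0 ->
  invmx W = scaled_id c k^-1 *m cycle_mx c s ->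
  (forall X, jacobian E (cycle_mx c s) X = 0 -> X = 0) ->
  (forall X, jacobian E (invmx W) X = 0 -> X = 0).
Proof.
move=> Ws k0 WE Jinj X JX; apply: Jinj; apply/matrixP => x y.
have WE' : invmx W = cycle_mx c s *m scaled_id c k^-1.
  by rewrite -{1}Ws -trmx_inv WE trmx_mul tr_cycle_mx // tr_diag_mx.
have z0 : (0 : 'M[R]_m) x y = 0 by rewrite mxE.
have := JX => /matrixP/(_ x y); rewrite z0.
rewrite [jacobian E (invmx W) X x y]mxE [jacobian _ _ _ _ _]mxE; case: ifP => // _.
rewrite {1}WE WE' -!mulmxA mul_diag_mx mxE !mulmxA mul_mx_diag [X in _ * X]mxE.
have dE z : (\row_w (if w \in c then k^-1 else 1) : 'rV[R]_m) 0 z =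
    if z \in c then k^-1 else 1 by rewrite mxE.
rewrite !dE => /eqP; rewrite oppr_eq0 !mulf_eq0.
have d0 z : (if z \in c then k^-1 else 1) == 0 = false.
  by case: ifP; rewrite ?invr_eq0 ?(negPf k0) // oner_eq0.
by rewrite !d0 orbF /= => /eqP ->; rewrite oppr0.
Qed.

(* The factor 'X excludes s = 0, which is 1 / (2 cos (2 a)) when cos (2 a) = 0. *)
Definition degeneracy_poly : {poly R} :=
  'X * \det (cycle_mx c ('X : {poly R})) *
    \det (lin_mx (jacobian E (cycle_mx c ('X : {poly R})))).

Lemma horner_cycle_mx s :
  map_mx (horner_eval s) (cycle_mx c ('X : {poly R})) = cycle_mx c s.
Proof.
apply/matrixP => x y; rewrite mxE !cycle_mx_entry /horner_eval.
by rewrite !hornerE -!polyC_natr !hornerC.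
Qed.

Lemma horner_det_jacobian s :
  (\det (lin_mx (jacobian E (cycle_mx c ('X : {poly R}))))).[s] =
  \det (lin_mx (jacobian E (cycle_mx c s))).
Proof.
rewrite -/(horner_eval s _) -det_map_mx; congr (\det _); apply: map_lin_mx => A.
apply/matrixP => x y; rewrite [LHS]mxE ![jacobian _ _ _ _ _]mxE; case: (E x y).
  by rewrite !mxE.
rewrite rmorphN; congr (- _).
by rewrite -horner_cycle_mx -!map_mxM [RHS]mxE.
Qed.

Lemma horner_degeneracy s : degeneracy_poly.[s] =
  s * \det (cycle_mx c s) * \det (lin_mx (jacobian E (cycle_mx c s))).
Proof.
rewrite /degeneracy_poly !hornerM hornerX horner_det_jacobian.
by rewrite -/(horner_eval s _) -det_map_mx horner_cycle_mx.
Qed.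

(** At [s = 0] the cycle matrix is the identity, and the Jacobian only changes signs off the
    edges. *)
Lemma degeneracy_poly_neq0 : degeneracy_poly != 0.
Proof.
have K0 : cycle_mx c (0 : R) = 1%:M by rewrite /cycle_mx scale0r subr0.
rewrite /degeneracy_poly !mulf_neq0 ?polyX_eq0 //.
  apply/eqP => /(congr1 (horner_eval 0)); rewrite -det_map_mx horner_cycle_mx.
  by rewrite K0 det1 rmorph0 => /eqP; rewrite oner_eq0.
apply/eqP => /(congr1 (horner_eval 0)); rewrite /horner_eval horner_det_jacobian K0.
rewrite horner0; apply/eqP; rewrite -unitfE -unitmxE; apply/lin_mx_unitP => X JX.
apply/matrixP => x y; have := JX => /matrixP/(_ x y).
have z0 : (0 : 'M[R]_m) x y = 0 by rewrite mxE.
rewrite mxE mul1mx mulmx1 z0.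
by case: ifP => // _ /eqP; rewrite oppr_eq0 => /eqP.
Qed.

(** The witness is [wave_mx c a]. On the edges it depends on [x] but not otherwise on [a], so two
    angles with the same ratio share their data; the form of the inverse serves to tell them
    apart. *)
Lemma generic_cycle_completion (a x : R) : 0 < a < pi / 2 ->
  cos ((size c)%:R * a) != 0 ->
  cos (((size c)%:R - 2) * a) = x * cos ((size c)%:R * a) ->
  ~~ root degeneracy_poly (2 * cos (2 * a))^-1 ->
  exists W : 'M[R]_m, [/\ completion E W W,
    forall X, jacobian E (invmx W) X = 0 -> X = 0,
    forall y z, E y z -> W y z =
      if cycle_adj c y z then x else (y == z)%:R &
    exists2 k, k != 0 & invmx W =
      scaled_id c k^-1 *m cycle_mx c (2 * cos (2 * a))^-1].
Proof.
set s := (2 * _)^-1 => a_in n0 ax.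
rewrite rootE horner_degeneracy !mulf_eq0 !negb_or => /andP[/andP[s0 dK] dJ].
have w0E : wave_entry c a 0 = cos ((size c)%:R * a).
  by rewrite /wave_entry muln0 sub0r mulNr cosN.
have w1E : wave_entry c a 1 = cos (((size c)%:R - 2) * a).
  by rewrite /wave_entry muln1 -cosN -mulNr opprB.
have w0 : wave_entry c a 0 != 0 by rewrite w0E.
have ratioE : wave_entry c a 1 / wave_entry c a 0 = x.
  by rewrite w1E w0E ax mulfK.
have sa : s * (2 * cos (2 * a)) = 1.
  by rewrite mulVf // -invr_eq0.
have KW := cycle_mx_wave c_uniq c_size w0 sa.
have uK : cycle_mx c s \in unitmx by rewrite unitmxE unitfE.
have Ws := tr_wave_mx c a.
have [k0 cW WE] := completion_cycle (ltnW (ltnW (ltnW c_size))) uK Ws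
  (wave_mx_diag w0) KW.
exists (wave_mx c a); split=> //.
- apply: jacobian_scaled WE _ => //; apply/lin_mx_unitP.
  by rewrite unitmxE unitfE.
- move=> y z yz; case: ifPn => [ayz|nayz].
    by rewrite (wave_mx_adj c_uniq c_size).
  have [<-|nyz] := eqVneq y z; first by rewrite wave_mx_diag.
  rewrite mxE (negPf nyz); case: ifP => // /andP[yc zc].
  by move: yz; rewrite c_chordless // (negPf nyz) (negPf nayz).
- by exists (1 - 2 * s * (wave_entry c a 1 / wave_entry c a 0)).
Qed.

Lemma chordless_cycle_ML_degree : ~ has_ML_degree R E 1.
Proof.
pose n : R := (size c)%:R; pose rs := rootsR degeneracy_poly.
pose angle (s : R) := acos (s^-1 / 2) / 2.
pose x_of (s : R) := cos ((n - 2) * angle s) / cos (n * angle s).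
(* x_of recovers the ratio x from the parameter s = 1 / (2 cos (2 a)), also when
   cos (2 a) = 0 since 0^-1 = 0. *)
have [x x1 x_rs] := exists_gt1_notin [seq x_of s | s <- rs].
have [a [b [a0 ab b_pi /andP[na nb] [xa xb]]]] := cos_ratio_pair c_size x1.
have nonroot (d : R) : 0 < d < pi / 2 -> cos (n * d) != 0 ->
    cos ((n - 2) * d) = x * cos (n * d) ->
    ~~ root degeneracy_poly (2 * cos (2 * d))^-1.
  (* If the parameter were a root, [x] would be its value under [x_of], against the choice of [x];
     [acos] recovers [2 * d] because it lies in [[0, pi]]. *)
  move=> d_in nd xd; apply: contra x_rs => rt; apply/mapP.
  exists (2 * cos (2 * d))^-1.
    have := roots_on_rootsR degeneracy_poly_neq0 (2 * cos (2 * d))^-1.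
    by rewrite rt in_itv /= => <-.
  rewrite /x_of /angle invrK [2 * cos _]mulrC mulfK ?pnatr_eq0 // cosK.
    by rewrite [2 * d]mulrC mulfK ?pnatr_eq0 // xd mulfK.
  by rewrite in_itv /=; lra.
have a_in : 0 < a < pi / 2 by rewrite a0 (lt_trans ab).
have b_in : 0 < b < pi / 2 by rewrite b_pi (lt_trans a0).
have [W1 [c1 J1 E1 [k1 k10 inv1]]] :=
  generic_cycle_completion a_in na xa (nonroot _ a_in na xa).
have [W2 [c2 J2 E2 [k2 k20 inv2]]] :=
  generic_cycle_completion b_in nb xb (nonroot _ b_in nb xb).
have c2' : completion E W1 W2.
  by case: c2 => uW Ws _ WK; split => // y z yz; rewrite E1 // E2.
have [_ W1s _ _] := c1.
apply: (two_completions_ML_degree E_sym W1s _ c1 c2' J1 J2).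
apply/eqP => W12; have [y yc] : exists y, y \in c.
  by case: (c) c_size => // y p _; exists y; rewrite mem_head.
have inv12 : scaled_id c k1^-1 *m cycle_mx c (2 * cos (2 * a))^-1 =
    scaled_id c k2^-1 *m cycle_mx c (2 * cos (2 * b))^-1.
  by rewrite -inv1 -inv2 W12.
(* The diagonal entry gives [k1 = k2]; the entry at the next vertex then gives
   [cos (2 a) = cos (2 b)], although [cos] is injective on [[0, pi]]. *)
have entry z := congr1 (fun A : 'M[R]_m => A y z) inv12.
have := entry y; have := entry (next c y).
rewrite !mul_diag_mx !mxE yc eqxx cycle_adj_irr // /cycle_adj yc mem_next yc.
rewrite eqxx /= [y == _]eq_sym (negPf (next_neq c_uniq c_size yc)).
rewrite !mulr1n !mulr0n !mulr1 !mulr0 !subr0 !sub0r !mulr1 => eN /invr_inj k12.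
move: eN; rewrite k12 => /(mulfI (invr_neq0 k20))/oppr_inj/invr_inj.
have two0 : 2 != 0 :> R by rewrite pnatr_eq0.
move=> /(mulfI two0) cos_ab.
have in_pi (d : R) : 0 < d < pi / 2 -> 2 * d \in `[0, pi].
  by rewrite in_itv /=; lra.
have := cos_inj (in_pi _ a_in) (in_pi _ b_in) cos_ab.
by move=> /(mulfI two0) abE; rewrite abE ltxx in ab.
Qed.

End ChordlessCycle.

Theorem theorem4p3 (R : realType) (m : nat) (E : rel 'I_m)
    (E_sym : symmetric E) (E_refl : reflexive E) :
  chordal E <-> ML_degree R E = 1%N.
Proof.
split=> [chE|deg1].
  exact/ML_degreeE/chordal_has_ML_degree1.
(* The value 1 is not the default 0 of [ML_degree], so a generic number of critical points
   exists. *)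
have has1 : has_ML_degree R E 1.
  have [[d dE]|none] := pselect (exists d, has_ML_degree R E d).
    by rewrite -deg1 (ML_degreeE dE).
  suff d0 : ML_degree R E = 0%N by rewrite d0 in deg1.
  by rewrite /ML_degree; case: xgetP => // d _ dE; case: none; exists d.
move=> c uc c4; apply: contrapT => nc; have /andP[_ c_uniq] := uc.
have c_chordless := chordless_edge E_sym E_refl uc nc.
exact: (chordless_cycle_ML_degree E_sym E_refl c_uniq c4 c_chordless has1).
Qed.
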